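(* Let $n\ge 1$ and let $\lambda=\{\lambda_0<\lambda_1<\dots<\lambda_n\}$ be a set of distinct real numbers. The space $M_{\mathrm{St}_n,\lambda}$ of Hermitian arrow matrices of size $(n+1)\times(n+1)$ with spectrum $\lambda$ is a smooth manifold of dimension $2n$. The space $M^{\mathbb{R}}_{\mathrm{St}_n,\lambda}$ of real symmetric arrow matrices of size $(n+1)\times(n+1)$ with spectrum $\lambda$ is a smooth manifold of dimension $n$. The action of $T^n$ on $M_{\mathrm{St}_n,\lambda}$ and the action of $\mathbb{Z}_2^n$ on $M^{\mathbb{R}}_{\mathrm{St}_n,\lambda}$ are locally standard.
   Context: Rows and columns are indexed by $0,1,\dots,n$. A Hermitian arrow matrix is a Hermitian $(n+1)\times(n+1)$-matrix $A=(a_{ij})$ whose entries vanish outside the main diagonal, the row $0$ and the column $0$. Write $a_i=a_{ii}\in\mathbb{R}$ ($i=0,\dots,n$) and $b_i=a_{0i}\in\mathbb{C}$, $a_{i0}=\overline{b_i}$ ($i=1,\dots,n$). The real vector space of such matrices is $M_{\mathrm{St}_n}\cong\mathbb{R}^{n+1}\times\mathbb{C}^n$. $M_{\mathrm{St}_n,\lambda}\subset M_{\mathrm{St}_n}$ is the subset of matrices with eigenvalues $\lambda_0,\dots,\lambda_n$, and $M^{\mathbb{R}}_{\mathrm{St}_n,\lambda}$ is its subset of matrices with all $b_i$ real; they are viewed as subsets of the vector spaces of Hermitian (resp. real symmetric) arrow matrices. The torus of diagonal unitary matrices $T^{n+1}$ acts by conjugation $A\mapsto DAD^{-1}$, i.e.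 $a_{ij}\mapsto t_it_j^{-1}a_{ij}$; scalar matrices act trivially, so there is an effective action of $T^n=T^{n+1}/\Delta(T^1)$, where $\Delta(T^1)$ is the subgroup of scalar matrices. Similarly, conjugation by diagonal matrices with entries $\pm1$ gives an action of $\mathbb{Z}_2^n=\mathbb{Z}_2^{n+1}/\Delta(\mathbb{Z}_2)$ on $M^{\mathbb{R}}_{\mathrm{St}_n,\lambda}$. A smooth action of $T^n$ on a $2n$-manifold (resp. of $\mathbb{Z}_2^n$ on an $n$-manifold) is locally standard if every point has an invariant neighbourhood which is equivariantly diffeomorphic, up to an automorphism of the acting group, to an invariant open subset of $\mathbb{C}^n$ with the standard coordinatewise action of $T^n$ (resp. of $\mathbb{R}^n$ with the standard coordinatewise sign action of $\mathbb{Z}_2^n$). *)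

(* Defs.v *)
From HB Require Import structures.
From mathcomp Require Import all_boot all_order all_algebra.
From mathcomp Require Import complex.
From mathcomp Require Import boolp classical_sets functions reals.
From mathcomp Require Import topology normedtype derive.

Set Implicit Arguments.
Unset Strict Implicit.
Unset Printing Implicit Defensive.

Import Order.TTheory GRing.Theory Num.Theory.
Import numFieldNormedType.Exports.

Local Open Scope classical_set_scope.
Local Open Scope ring_scope.
Local Open Scope complex_scope.

Section Smooth.
Context {R : realType}.

(* In finite dimension this is C^k in the usual sense, because every iterated
   directional derivative of order at most k exists and is continuous on U.
   It is only used for open U: 'D_v f x depends on f near x. *)
Fixpoint Ck {E F : normedModType R} (k : nat) (U : set E) (f : E -> F) : Prop :=
  if k is k'.+1 then
    (forall x, U x -> differentiable f x) /\
    (forall v, Ck k' U (fun x => 'D_v f x))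
  else forall x, U x -> {for x, continuous f}.

(* Smoothness on an arbitrary subset: locally the restriction of a smooth
   function defined on an open set of the ambient space. *)
Definition smooth_on {E F : normedModType R} (X : set E) (f : E -> F) : Prop :=
  forall x, X x -> exists (O : set E) (g : E -> F),
    [/\ open O, O x, forall k, Ck k O g & forall y, X y -> O y -> g y = f y].

Definition diffeo {E F : normedModType R} (X : set E) (Y : set F)
    (f : E -> F) (g : F -> E) : Prop :=
  [/\ (forall x, X x -> Y (f x) /\ g (f x) = x),
      (forall y, Y y -> X (g y) /\ f (g y) = y),
      smooth_on X f & smooth_on Y g].

Definition rel_open {E : normedModType R} (A B : set E) : Prop :=
  exists2 O : set E, open O & B = A `&` O.

(* M is an (embedded) smooth manifold of dimension d: every point has a
   relatively open neighbourhood in M diffeomorphic to an open set of R^d. *)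
Definition smooth_manifold {E : normedModType R} (d : nat) (M : set E) : Prop :=
  forall x, M x ->
    exists (U : set E) (V : set 'rV[R]_d) (f : E -> 'rV[R]_d) (g : 'rV[R]_d -> E),
      [/\ rel_open M U, U x, open V & diffeo U V f g].

End Smooth.

Section LocallyStandard.
Context {R : realType} {V W E : normedModType R}.
(* The acting group is G / N, where G is a group (for mulV, with unit oneV)
   contained in V.  The standard group H is contained in W and acts on W by
   mulW (coordinatewise multiplication). *)
Variables (mulV : V -> V -> V) (oneV : V) (G N : set V).
Variables (mulW : W -> W -> W) (H : set W).
Variables (act : V -> E -> E) (M : set E).

Definition smooth_action : Prop :=
  [/\ (forall t x, G t -> M x -> M (act t x)),
      (forall x, M x -> act oneV x = x),
      (forall s t x, G s -> G t -> M x -> act (mulV s t) x = act s (act t x)),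
      (forall t x, N t -> M x -> act t x = x) &
      smooth_on (G `*` M) (fun p : V * E => act p.1 p.2)].

(* phi induces an isomorphism of topological groups from G / N onto H; the last
   condition says that the topology of H is the quotient topology. *)
Definition quotient_iso (phi : V -> W) : Prop :=
  [/\ phi @` G = H,
      (forall s t, G s -> G t -> phi (mulV s t) = mulW (phi s) (phi t)),
      (forall s t, G s -> G t ->
         (phi s = phi t <-> exists2 u, N u & s = mulV u t)) &
      (forall B, B `<=` H ->
         (rel_open H B <-> rel_open G (G `&` phi @^-1` B)))].

(* An isomorphism G / N -> H is a fixed identification of the two groups
   followed by an automorphism of H, so that letting phi vary is equivariance
   up to an automorphism of the acting group. *)
Definition locally_standard : Prop :=
  smooth_action /\
  forall x, M x ->
    exists (U : set E) (D : set W) (phi : V -> W) (f : E -> W) (g : W -> E),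
      [/\ [/\ rel_open M U, U x & forall t y, G t -> U y -> U (act t y)],
          open D /\ (forall h z, H h -> D z -> D (mulW h z)),
          quotient_iso phi,
          diffeo U D f g &
          forall t y, G t -> U y -> f (act t y) = mulW (phi t) (f y)].

End LocallyStandard.

(* C^m as a real normed space: pairs (real parts, imaginary parts). *)
Notation Cspace R m := ('rV[R]_m * 'rV[R]_m)%type.

Section Coordinates.
Context {R : realType} {m : nat}.

Definition cvec (z : Cspace R m) : 'rV[R[i]]_m :=
  \row_j (z.1 0 j +i* z.2 0 j).

Definition rvec (z : 'rV[R[i]]_m) : Cspace R m :=
  (\row_j complex.Re (z 0 j), \row_j complex.Im (z 0 j)).

Lemma cvecK : cancel cvec rvec.
Proof. by case=> a b; congr pair; apply/rowP => j; rewrite !mxE. Qed.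

Lemma rvecK : cancel rvec cvec.
Proof. by move=> z; apply/rowP => j; rewrite !mxE /=; case: (z 0 j). Qed.

Definition rmul (s t : 'rV[R]_m) : 'rV[R]_m := \row_j (s 0 j * t 0 j).

Definition cmul (s t : Cspace R m) : Cspace R m :=
  rvec (\row_j (cvec s 0 j * cvec t 0 j)).

Definition rone : 'rV[R]_m := const_mx 1.
Definition cone : Cspace R m := rvec (const_mx 1).

Definition signs : set 'rV[R]_m :=
  [set t | forall j, t 0 j = 1 \/ t 0 j = -1].

Definition torus : set (Cspace R m) :=
  [set t | forall j, `|cvec t 0 j| = 1].

Definition scalar_signs : set 'rV[R]_m :=
  signs `&` [set t | exists c, t = const_mx c].

Definition scalar_torus : set (Cspace R m) :=
  torus `&` [set t | exists c, cvec t = const_mx c].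

End Coordinates.
Arguments signs R m : clear implicits.
Arguments torus R m : clear implicits.
Arguments scalar_signs R m : clear implicits.
Arguments scalar_torus R m : clear implicits.

Section Arrow.

Definition is_arrow (K : fieldType) n (A : 'M[K]_n.+1) : Prop :=
  forall i j, i != 0 -> j != 0 -> i != j -> A i j = 0.

(* Used for n distinct mu i, which are then all the eigenvalues, each simple. *)
Definition has_spectrum (K : fieldType) n (A : 'M[K]_n) (mu : 'I_n -> K) : Prop :=
  forall z, eigenvalue A z <-> exists i, z = mu i.

(* Diagonal a, row 0 given by b off the diagonal, column 0 by the conjugate. *)
Definition arrow_mx (K : fieldType) (conj : K -> K) n
    (a : 'rV[K]_n.+1) (b : 'rV[K]_n) : 'M[K]_n.+1 :=
  \matrix_(i, j)
    match unlift 0 i, unlift 0 j with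
    | None, None => a 0 0
    | None, Some j' => b 0 j'
    | Some i', None => conj (b 0 i')
    | Some _, Some _ => if i == j then a 0 i else 0
    end.

Lemma arrow_mx_is_arrow (K : fieldType) (conj : K -> K) n a b :
  is_arrow (@arrow_mx K conj n a b).
Proof.
move=> i j i0 j0 ij; rewrite mxE.
case: unliftP => [i'|] ei; last by rewrite ei eqxx in i0.
case: unliftP => [j'|] ej; last by rewrite ej eqxx in j0.
by rewrite (negbTE ij).
Qed.

Lemma conj_diag_mxE (K : fieldType) n (d : 'rV[K]_n) (A : 'M[K]_n) i j :
  (forall k, d 0 k != 0) ->
  (diag_mx d *m A *m invmx (diag_mx d)) i j = d 0 i * A i j / d 0 j.
Proof.
move=> d0; have dV : diag_mx d *m diag_mx (\row_k (d 0 k)^-1) = 1%:M.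
  apply/matrixP => k l; rewrite mul_diag_mx !mxE.
  by case: (k == l); rewrite ?mulr0n ?mulr0 ?mulr1n ?mulfV.
have [du _] := mulmx1_unit dV.
have -> : invmx (diag_mx d) = diag_mx (\row_k (d 0 k)^-1).
  by rewrite -[LHS]mulmx1 -dV mulKmx.
by rewrite mul_mx_diag mul_diag_mx !mxE.
Qed.

Context {R : realType} {n : nat}.

Definition herm_arrow : set 'M[R[i]]_n.+1 :=
  [set A | A \is hermsymmx /\ is_arrow A].

Definition symm_arrow : set 'M[R]_n.+1 :=
  [set A | A \is symmetricmx /\ is_arrow A].

(* The real vector space R^(n+1) x C^n of Hermitian arrow matrices, and
   R^(n+1) x R^n for the real symmetric ones. *)
Definition herm_mx (x : 'rV[R]_n.+1 * Cspace R n) : 'M[R[i]]_n.+1 :=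
  arrow_mx Num.conj (\row_i (x.1 0 i)%:C) (cvec x.2).

Definition herm_coord (A : 'M[R[i]]_n.+1) : 'rV[R]_n.+1 * Cspace R n :=
  (\row_i complex.Re (A i i), rvec (\row_j A 0 (lift 0 j))).

Definition symm_mx (x : 'rV[R]_n.+1 * 'rV[R]_n) : 'M[R]_n.+1 :=
  arrow_mx idfun x.1 x.2.

Definition symm_coord (A : 'M[R]_n.+1) : 'rV[R]_n.+1 * 'rV[R]_n :=
  (\row_i A i i, \row_j A 0 (lift 0 j)).

Lemma herm_mx_arrow x : herm_arrow (herm_mx x).
Proof.
split; last exact: arrow_mx_is_arrow.
apply/is_hermitianmxP; rewrite expr0 scale1r; apply/matrixP => i j.
have cR (r : R) : Num.conj r%:C = r%:C
  by apply/eqP; rewrite eq_complex /= oppr0 !eqxx.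
rewrite !mxE; case: unliftP => [i'|] ei; case: unliftP => [j'|] ej //=.
- by rewrite eq_sym; case: eqP => [->|_]; rewrite ?rmorph0 ?cR.
- by rewrite conjCK.
Qed.

Lemma herm_mxK : cancel herm_mx herm_coord.
Proof.
case=> a b; congr pair; last rewrite -[RHS]cvecK; last congr rvec.
  apply/rowP => i; rewrite !mxE.
  by case: unliftP => [i'|] -> //=; rewrite eqxx.
by apply/rowP => j; rewrite 2!mxE unlift_none liftK.
Qed.

Lemma herm_coordK A : herm_arrow A -> herm_mx (herm_coord A) = A.
Proof.
case=> /is_hermitianmxP; rewrite expr0 scale1r => AH Aa.
have AE i j : A i j = Num.conj (A j i) by rewrite {1}AH !mxE.
have dR i : (complex.Re (A i i))%:C = A i i.
  have := AE i i; case: (A i i) => x y /= [] /eqP.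
  by rewrite -subr_eq0 opprK -mulr2n mulrn_eq0 /= => /eqP ->.
apply/matrixP => i j; rewrite mxE /= rvecK.
case: unliftP => [i'|] ei; case: unliftP => [j'|] ej /=.
- case: eqP => [<-|/eqP ij]; first by rewrite !mxE dR.
  by rewrite Aa // ?ei ?ej.
- by rewrite mxE -AE ei ej.
- by rewrite mxE ei ej.
- by rewrite !mxE dR ei ej.
Qed.

Lemma symm_mx_arrow x : symm_arrow (symm_mx x).
Proof.
split; last exact: arrow_mx_is_arrow.
apply/is_hermitianmxP; rewrite expr0 scale1r; apply/matrixP => i j.
rewrite !mxE; case: unliftP => [i'|] ei; case: unliftP => [j'|] ej //=.
by rewrite eq_sym; case: eqP => [->|].
Qed.

Lemma symm_mxK : cancel symm_mx symm_coord.
Proof.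
case=> a b; congr pair; apply/rowP => i; rewrite !mxE.
  by case: unliftP => [i'|] -> //=; rewrite eqxx.
by rewrite unlift_none liftK.
Qed.

Lemma symm_coordK A : symm_arrow A -> symm_mx (symm_coord A) = A.
Proof.
case=> /is_hermitianmxP; rewrite expr0 scale1r => AH Aa.
have AE i j : A i j = A j i by rewrite {1}AH !mxE.
apply/matrixP => i j; rewrite mxE /=.
case: unliftP => [i'|] ei; case: unliftP => [j'|] ej //=.
- case: eqP => [<-|/eqP ij]; first by rewrite !mxE.
  by rewrite Aa // ?ei ?ej.
- by rewrite mxE -AE ei ej.
- by rewrite mxE ei ej.
- by rewrite !mxE ei ej.
Qed.

Definition herm_isospectral (lambda : 'I_n.+1 -> R) :
    set ('rV[R]_n.+1 * Cspace R n) :=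
  herm_coord @`
    [set A | herm_arrow A /\ has_spectrum A (fun i => (lambda i)%:C)].

Definition symm_isospectral (lambda : 'I_n.+1 -> R) :
    set ('rV[R]_n.+1 * 'rV[R]_n) :=
  symm_coord @` [set A | symm_arrow A /\ has_spectrum A lambda].

Definition herm_act (t : Cspace R n.+1) (x : 'rV[R]_n.+1 * Cspace R n) :
    'rV[R]_n.+1 * Cspace R n :=
  herm_coord (diag_mx (cvec t) *m herm_mx x *m invmx (diag_mx (cvec t))).

Definition symm_act (t : 'rV[R]_n.+1) (x : 'rV[R]_n.+1 * 'rV[R]_n) :
    'rV[R]_n.+1 * 'rV[R]_n :=
  symm_coord (diag_mx t *m symm_mx x *m invmx (diag_mx t)).

Lemma herm_actE t x : torus R n.+1 t ->
  herm_mx (herm_act t x) =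
    diag_mx (cvec t) *m herm_mx x *m invmx (diag_mx (cvec t)).
Proof.
move=> tT; have t0 k : cvec t 0 k != 0 by rewrite -normr_gt0 tT ltr01.
have tV k : (cvec t 0 k)^-1 = Num.conj (cvec t 0 k).
  by rewrite invC_norm tT expr1n invr1 mul1r.
apply: herm_coordK; have [/is_hermitianmxP xH xa] := herm_mx_arrow x; split.
  apply/is_hermitianmxP; apply/matrixP => i j.
  have xE : herm_mx x i j = Num.conj (herm_mx x j i).
    by rewrite {1}xH expr0 scale1r mxE [in LHS]mxE.
  rewrite expr0 scale1r conj_diag_mxE // [RHS]mxE [in RHS]mxE conj_diag_mxE //.
  by rewrite !tV !rmorphM /= conjCK xE mulrC [X in _ * X]mulrC mulrA.
by move=> i j i0 j0 ij; rewrite conj_diag_mxE // xa // mulr0 mul0r.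
Qed.

Lemma symm_actE t x : signs R n.+1 t ->
  symm_mx (symm_act t x) = diag_mx t *m symm_mx x *m invmx (diag_mx t).
Proof.
move=> tS; have t0 k : t 0 k != 0.
  by case: (tS k) => ->; rewrite ?oppr_eq0 oner_eq0.
have tV k : (t 0 k)^-1 = t 0 k by case: (tS k) => ->; rewrite ?invrN invr1.
apply: symm_coordK; have [/is_hermitianmxP xH xa] := symm_mx_arrow x; split.
  apply/is_hermitianmxP; apply/matrixP => i j.
  have xE : symm_mx x i j = symm_mx x j i.
    by rewrite {1}xH expr0 scale1r mxE [in LHS]mxE.
  rewrite expr0 scale1r conj_diag_mxE // [RHS]mxE [in RHS]mxE conj_diag_mxE //.
  by rewrite /= !tV xE mulrC [X in _ * X]mulrC mulrA.
by move=> i j i0 j0 ij; rewrite conj_diag_mxE // xa // mulr0 mul0r.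
Qed.

End Arrow.

(* Main.v *)
Require Import Defs.
From HB Require Import structures.
From mathcomp Require Import all_boot all_order all_algebra.
From mathcomp Require Import complex.
From mathcomp Require Import boolp classical_sets functions reals.
From mathcomp Require Import topology normedtype derive realfun landau.
From mathcomp Require Import ring.

(** The characteristic polynomial of an arrow matrix with diagonal
    a_0, a_1, ..., a_n and border b sees b only through s_i = |b_i|^2:

      chi = (X - a_0) prod_i (X - a_i) - sum_i s_i prod_(m <> i) (X - a_m),

    and a matrix is isospectral exactly when chi is P = prod_k (X - l_k)
    ([arrow_poly_rootsP], [eigenvalue_arrow]).  Comparing the values at a_i,

      P(a_i) = - s_i prod_(m <> i) (a_i - a_m),

    so s is a rational function of a wherever the a_i are distinct, and a_0 is
    given by the trace.  The whole difficulty is to find coordinates where this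
    description degenerates, which happens in two ways.

    - Some s_i vanishes while a_i differs from the other a_m.  Then a_i is an
      eigenvalue l_k, the factor a_i - l_k of P(a_i) is responsible for the
      zero, and a_i = l_k + e |z_i|^2 with e = 1 or -1 turns the equation above
      into b_i = z_i sqrt(H_i) with H_i rational and positive.
    - Two diagonal entries a_i and a_j collide.  Since P has simple roots, the
      common value is some l_k, no third entry meets it, and s_i + s_j <> 0, say
      s_j <> 0.  Putting a_i - l_k = - (a_j - l_k) |z_i|^2 makes the dangerous
      difference a_i - a_j = - (a_j - l_k) (1 + |z_i|^2), so that the factor
      a_j - l_k cancels from the formulas for both s_i and s_j, and again
      b_i = z_i sqrt(H_i), b_j = z_j sqrt(H_j) with positive rational H.

    At all other indices, the j of a colliding pair included, b_i <> 0 and a_i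
    itself can serve as a coordinate: a_i = c_i + |z_i|^2 for some constant
    c_i < a_i.  The resulting parametrization z |-> (a, b) and its inverse
    z_i = b_i sqrt(K_i) are explicit, and smooth because they are built from
    rational functions and square roots of positive quantities
    ([chart_isospectral], [chart_coscaleK], [backward_diag], [backward_scaleK],
    and [isospectral_chart] for the smooth statement).

    Every chart multiplies each coordinate of b by a positive function of a and
    of the |b_i|^2.  A diagonal t fixes a and multiplies b_j by t_0 / t_j, hence
    the charts are equivariant, and t |-> (t_0 / t_j)_j identifies the acting
    group modulo scalars with the standard one
    ([isospectral_locally_standard]).  Real and complex b are two instances of
    this one argument. *)

Set Implicit Arguments.
Unset Strict Implicit.
Unset Printing Implicit Defensive.

Import Order.TTheory GRing.Theory Num.Theory.
Import numFieldNormedType.Exports.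

Local Open Scope classical_set_scope.
Local Open Scope ring_scope.

(** * Calculus of smooth functions *)

Section CkCalculus.
Context {R : realType}.
Implicit Types E F G : normedModType R.

(** Differentiability is a statement about the germ of a function: the
    remainders of [f] and [g] agree near [0]. *)
Lemma near_eq_differentiable E F (f g : E -> F) x :
  (\near x, f x = g x) -> differentiable f x -> differentiable g x.
Proof.
move=> fg df; have dfc := diff_continuous df.
have gE : g \o shift x = cst (g x) + 'd f x +o_ 0 id.
  have /eqaddoP fo := diff_locally df.
  apply/eqaddoP => e e0; have := fo _ e0; apply: filter_app.
  have fgx := nbhs_singleton fg.
  have fgh : \forall h \near 0, f (h + x) = g (h + x).
    by move: fg; rewrite (near_shift 0 x) /= subr0.
  near=> h.
  suff -> : (g \o shift x - (cst (g x) + 'd f x)) h =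
            (f \o shift x - (cst (f x) + 'd f x)) h by [].
  have uE (u : E -> F) : (u \o shift x - (cst (u x) + 'd f x)) h =
      u (h + x) - (u x + 'd f x h) by [].
  rewrite (uE f) (uE g).
  rewrite fgx; congr (_ - _); apply/esym; near: h; exact: fgh.
by apply/diff_locallyP; rewrite (diff_unique dfc gE).
Unshelve. all: by end_near. Qed.

Lemma open_near (T : topologicalType) (U : set T) x (P : T -> Prop) :
  open U -> U x -> (forall y, U y -> P y) -> \near x, P x.
Proof.
by move=> oU Ux UP; apply: filterS UP _; apply: open_nbhs_nbhs; split.
Qed.

Lemma Ck_ext E F k (U : set E) (f g : E -> F) : open U ->
  (forall x, U x -> f x = g x) -> Ck k U f -> Ck k U g.
Proof.
move=> oU; elim: k f g => [|k IH] f g fg /=.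
  move=> fc x Ux; rewrite /prop_for /continuous_at -(fg x Ux).
  apply: cvg_trans (fc x Ux); apply: near_eq_cvg.
  exact: open_near oU Ux fg.
move=> [fd fD]; split.
  move=> x Ux; apply: near_eq_differentiable (fd x Ux).
  exact: open_near oU Ux fg.
move=> v; apply: IH (fD v) => x Ux; apply: near_eq_derive.
exact: open_near oU Ux fg.
Qed.

Lemma Ck_sub E F k (U V : set E) (f : E -> F) :
  V `<=` U -> Ck k U f -> Ck k V f.
Proof.
move=> VU; elim: k f => [|k IH] f /= => [fc x /VU|[fd fD]]; first exact: fc.
by split=> [x /VU|v]; [apply: fd|apply: IH].
Qed.

Lemma CkS E F k (U : set E) (f : E -> F) : Ck k.+1 U f -> Ck k U f.
Proof.
elim: k f => [|k IH] f [fd fD].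
  by move=> x Ux; apply: differentiable_continuous; apply: fd.
by split=> // v; apply: IH.
Qed.

Lemma Ck_cst E F k (U : set E) (c : F) : Ck k U (fun=> c).
Proof.
elim: k c => [|k IH] c /=; first by move=> x _; apply: cvg_cst.
split=> [x _|v]; first exact: differentiable_cst.
have -> : (fun x => 'D_v (fun=> c) x) = (fun=> 0 : F).
  by apply/funext => x; apply: derive_cst.
exact: IH.
Qed.

Lemma CkD E F k (U : set E) (f g : E -> F) : open U ->
  Ck k U f -> Ck k U g -> Ck k U (fun x => f x + g x).
Proof.
move=> oU; elim: k f g => [|k IH] f g.
  by move=> fc gc x Ux; apply: cvgD; [apply: fc|apply: gc].
move=> [fd fD] [gd gD]; split=> [x Ux|v].
  by apply: differentiableD; [apply: fd|apply: gd].
apply: Ck_ext (IH _ _ (fD v) (gD v)) => // x Ux.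
by rewrite -deriveD //; apply: diff_derivable; [apply: fd|apply: gd].
Qed.

Lemma CkM E k (U : set E) (f g : E -> R) : open U ->
  Ck k U f -> Ck k U g -> Ck k U (fun x => f x * g x).
Proof.
move=> oU; elim: k f g => [|k IH] f g.
  by move=> fc gc x Ux; apply: cvgM; [apply: fc|apply: gc].
move=> fk gk; have [fd fD] := fk; have [gd gD] := gk.
split=> [x Ux|v]; first by apply: differentiableM; [apply: fd|apply: gd].
have fgk : Ck k U (fun x => f x * 'D_v g x + g x * 'D_v f x).
  have [fk' gk'] := (CkS fk, CkS gk).
  by apply: CkD => //; [apply: IH (gD v)|apply: IH (fD v)].
apply: Ck_ext fgk => // x Ux.
by rewrite -[LHS]deriveM //; apply: diff_derivable; [apply: fd|apply: gd].
Qed.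

Lemma CkV E k (U : set E) (f : E -> R) : open U ->
  (forall x, U x -> f x != 0) -> Ck k U f -> Ck k U (fun x => (f x)^-1).
Proof.
move=> oU f0; elim: k => [|k IH].
  by move=> fc x Ux; apply: cvgV; [apply: f0|apply: fc].
move=> fk; have [fd fD] := fk; have fVk := IH (CkS fk).
split=> [x Ux|v]; first by apply: differentiableV; [apply: fd|apply: f0].
have fgk : Ck k U (fun x => -1 * ((f x)^-1 * (f x)^-1) * 'D_v f x).
  apply: CkM (fD v) => //; apply: CkM (CkM _ fVk fVk) => //.
  exact: Ck_cst.
apply: Ck_ext fgk => // x Ux.
rewrite [RHS](@deriveV _ _ f) ?f0 //; last by apply: diff_derivable; apply: fd.
by rewrite mulN1r -invfM -expr2 //.
Qed.

(** The derivative of [sqrt f] is [f' / (2 sqrt f)], in which [sqrt f] reappears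
    with one degree of smoothness less to prove; hence the induction on [k].
    The same pattern proves [CkM] and [CkV]. *)
Lemma Ck_sqrt E k (U : set E) (f : E -> R) : open U ->
  (forall x, U x -> 0 < f x) -> Ck k U f -> Ck k U (fun x => Num.sqrt (f x)).
Proof.
move=> oU f0; elim: k => [|k IH].
  move=> fc x Ux; apply: (@continuous_comp _ _ _ f); first exact: fc.
  exact: sqrt_continuous.
move=> fk; have [fd fD] := fk; have fsk := IH (CkS fk).
have sd (y : R) : 0 < y -> differentiable (@Num.sqrt R) y.
  by move=> y0; apply/derivable1_diffP; have [] := is_derive1_sqrt y0.
split=> [x Ux|v].
  by apply: (@differentiable_comp _ _ _ _ f); [apply: fd|apply/sd/f0].
have fgk : Ck k U (fun x => 'D_v f x * (2 * Num.sqrt (f x))^-1).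
  apply: CkM (fD v) _ => //; apply: CkV => //; last first.
    by apply: CkM fsk => //; apply: Ck_cst.
  by move=> x Ux; rewrite mulf_neq0 ?pnatr_eq0 // gt_eqF // sqrtr_gt0 f0.
apply: Ck_ext fgk => // x Ux.
have df := fd x Ux; have ds := sd _ (f0 x Ux).
rewrite [RHS]deriveE; last exact: (differentiable_comp df ds).
rewrite (diff_comp df ds) /= -(deriveE v df).
by rewrite deriv1E ?derive1E ?derive_sqrt ?f0 //; apply/derivable1_diffP.
Qed.

Lemma Ck_lin E F G k (U : set E) (L : {linear F -> G}) (f : E -> F) :
  open U -> continuous L -> Ck k U f -> Ck k U (fun x => L (f x)).
Proof.
move=> oU cL; elim: k f => [|k IH] f.
  by move=> fc x Ux; apply: (@continuous_comp _ _ _ f); [apply: fc|apply: cL].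
have dL y : differentiable L y by apply: linear_differentiable.
move=> [fd fD]; split=> [x Ux|v].
  by apply: (@differentiable_comp _ _ _ _ f) => //; apply: fd.
apply: Ck_ext (IH _ (fD v)) => // x Ux.
have df := fd x Ux; rewrite [RHS]deriveE; last exact: (differentiable_comp df (dL _)).
by rewrite (diff_comp df (dL _)) diff_lin //= -(deriveE v df).
Qed.

Lemma Ck_id E k (U : set E) : Ck k U (fun x => x).
Proof.
case: k => [|k]; first by move=> x _; apply: cvg_id.
split=> // v; have -> : (fun x => 'D_v (fun x : E => x) x) = (fun=> v : E).
  by apply/funext => x; apply: derive_id.
exact: Ck_cst.
Qed.

Lemma Ck_precomp E F G k (U : set F) (L : {linear E -> F}) (f : F -> G) :
  open U -> continuous L -> Ck k U f -> Ck k (L @^-1` U) (fun x => f (L x)).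
Proof.
move=> oU cL; have oV : open (L @^-1` U) by apply: open_comp.
elim: k f => [|k IH] f.
  by move=> fc x Ux; apply: (@continuous_comp _ _ _ L); [apply: cL|apply: fc].
have dL y : differentiable L y by apply: linear_differentiable.
move=> [fd fD]; split=> [x Ux|v].
  by apply: (@differentiable_comp _ _ _ _ L) => //; apply: fd.
apply: Ck_ext (IH _ (fD (L v))) => // x Ux.
have df := fd _ Ux; rewrite [RHS]deriveE; last exact: (differentiable_comp (dL _) df).
by rewrite (diff_comp (dL _) df) diff_lin //= -(deriveE _ df).
Qed.

End CkCalculus.

Section SmoothAt.
Context {R : realType}.
Implicit Types E F G : normedModType R.

(** One neighbourhood has to serve all orders of differentiability, as in
    [smooth_on].  Working at a point keeps track of the domains of quotients and
    roots: a chart function only has to be well defined at the point. *)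
Definition smooth_at E F (x : E) (f : E -> F) : Prop :=
  exists U : set E, [/\ open U, U x & forall k, Ck k U f].

Lemma smooth_at_on E F (X : set E) (f : E -> F) :
  (forall x, X x -> smooth_at x f) -> smooth_on X f.
Proof. by move=> fX x /fX [U [oU Ux fU]]; exists U, f; split. Qed.

Lemma smooth_at_continuous E F (x : E) (f : E -> F) :
  smooth_at x f -> {for x, continuous f}.
Proof. by case=> U [_ Ux /(_ 0%N)]; apply. Qed.

Lemma smooth_at_cst E F (x : E) (c : F) : smooth_at x (fun=> c).
Proof.
by exists setT; split=> // [|k]; [apply: openT|apply: Ck_cst].
Qed.

Lemma smooth_at_id E (x : E) : smooth_at x (fun y : E => y).
Proof. by exists setT; split=> // [|k]; [apply: openT|apply: Ck_id]. Qed.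

Lemma smooth_at2 E F F' G (x : E) (f : E -> F) (g : E -> F') (h : E -> G) :
  (forall k U, open U -> Ck k U f -> Ck k U g -> Ck k U h) ->
  smooth_at x f -> smooth_at x g -> smooth_at x h.
Proof.
move=> H [U [oU Ux fU]] [U' [oU' Ux' gU']]; exists (U `&` U'); split.
- exact: openI.
- by [].
have oI : open (U `&` U') by apply: openI.
move=> k; apply: H => //.
  by apply: Ck_sub (fU k) => y [].
by apply: Ck_sub (gU' k) => y [].
Qed.

Lemma smooth_atD E F (x : E) (f g : E -> F) :
  smooth_at x f -> smooth_at x g -> smooth_at x (fun y => f y + g y).
Proof. by apply: smooth_at2 => k U; apply: CkD. Qed.

(** Shrinks the neighbourhood so that an open condition on the values, valid at
    the point, holds throughout; inverses and roots need it. *)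
Lemma smooth_at_restrict E F (x : E) (f : E -> F) (B : set F) : open B ->
  B (f x) -> smooth_at x f ->
  exists U : set E, [/\ open U, U x, forall y, U y -> B (f y) & forall k, Ck k U f].
Proof.
move=> oB Bx [U [oU Ux fU]]; exists (U `&` f @^-1` B); split=> //.
- rewrite openE => y [Oy By]; apply: filterI; first by apply: open_nbhs_nbhs.
  by apply: (fU 0%N y Oy); apply: open_nbhs_nbhs.
- by move=> y [].
- by move=> k; apply: Ck_sub (fU k) => y [].
Qed.

Lemma smooth_atV E (x : E) (f : E -> R) :
  f x != 0 -> smooth_at x f -> smooth_at x (fun y => (f y)^-1).
Proof.
move=> f0 fx; have oB : open [set y : R | y != 0] by apply: open_neq.
have [U [oU Ux U0 fU]] := smooth_at_restrict oB f0 fx.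
by exists U; split=> // k; apply: CkV.
Qed.

Lemma smooth_at_sqrt E (x : E) (f : E -> R) :
  0 < f x -> smooth_at x f -> smooth_at x (fun y => Num.sqrt (f y)).
Proof.
move=> f0 fx; have oB : open [set y : R | 0 < y] by apply: open_gt.
have [U [oU Ux U0 fU]] := smooth_at_restrict oB f0 fx.
by exists U; split=> // k; apply: Ck_sqrt.
Qed.

Lemma smooth_at_lin E F G (L : F -> G) (x : E) (f : E -> F) :
  linear L -> continuous L -> smooth_at x f -> smooth_at x (fun y => L (f y)).
Proof.
move=> linL cL [U [oU Ux fU]]; exists U; split=> // k.
pose L' : {linear F -> G} := HB.pack L (GRing.isLinear.Build _ _ _ _ _ linL).
exact: (@Ck_lin _ _ _ _ k U L').
Qed.

Lemma smooth_atN E F (x : E) (f : E -> F) :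
  smooth_at x f -> smooth_at x (fun y => - f y).
Proof.
move=> fx; apply: (@smooth_at_lin _ _ _ (fun u : F => - u)) fx.
  by move=> a u v; rewrite scalerN opprD.
exact: opp_continuous.
Qed.

Lemma smooth_atB E F (x : E) (f g : E -> F) :
  smooth_at x f -> smooth_at x g -> smooth_at x (fun y => f y - g y).
Proof. by move=> fx gx; apply: smooth_atD => //; apply: smooth_atN. Qed.

Lemma smooth_atM E (x : E) (f g : E -> R) :
  smooth_at x f -> smooth_at x g -> smooth_at x (fun y => f y * g y).
Proof. by apply: smooth_at2 => k U; apply: CkM. Qed.

Lemma smooth_at_div E (x : E) (f g : E -> R) :
  g x != 0 -> smooth_at x f -> smooth_at x g -> smooth_at x (fun y => f y / g y).
Proof. by move=> g0 fx gx; apply: smooth_atM => //; apply: smooth_atV. Qed.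

Lemma smooth_at_sum E F (I : Type) (r : seq I) (P : pred I) (x : E)
    (f : I -> E -> F) : (forall i, P i -> smooth_at x (f i)) ->
  smooth_at x (fun y => \sum_(i <- r | P i) f i y).
Proof.
move=> fP; elim: r => [|i r IH].
  rewrite (_ : (fun y => _) = fun=> 0); first exact: smooth_at_cst.
  by apply/funext => y; rewrite big_nil.
rewrite (_ : (fun y => _) =
  if P i then fun y => f i y + \sum_(i <- r | P i) f i y else
  fun y => \sum_(i <- r | P i) f i y).
  by case: ifP => // Pi; apply: smooth_atD => //; apply: fP.
by apply/funext => y; rewrite big_cons; case: ifP.
Qed.

Lemma smooth_at_prod E (I : Type) (r : seq I) (P : pred I) (x : E)
    (f : I -> E -> R) : (forall i, P i -> smooth_at x (f i)) ->
  smooth_at x (fun y => \prod_(i <- r | P i) f i y).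
Proof.
move=> fP; elim: r => [|i r IH].
  rewrite (_ : (fun y => _) = fun=> 1); first exact: smooth_at_cst.
  by apply/funext => y; rewrite big_nil.
rewrite (_ : (fun y => _) =
  if P i then fun y => f i y * \prod_(i <- r | P i) f i y else
  fun y => \prod_(i <- r | P i) f i y).
  by case: ifP => // Pi; apply: smooth_atM => //; apply: fP.
by apply/funext => y; rewrite big_cons; case: ifP.
Qed.

Lemma smooth_at_pair E F G (x : E) (f : E -> F) (g : E -> G) :
  smooth_at x f -> smooth_at x g -> smooth_at x (fun y => (f y, g y)).
Proof.
move=> fx gx; have -> : (fun y => (f y, g y)) = (fun y => (f y, 0) + (0, g y)).
  by apply/funext => y; congr pair; rewrite /= ?addr0 ?add0r.
apply: smooth_atD.
  apply: (@smooth_at_lin _ _ _ (fun u : F => (u, 0 : G))) fx.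
    by move=> a u v; congr pair; rewrite /= scaler0 addr0.
  by move=> u; apply: cvg_pair; [apply: cvg_id|apply: cvg_cst].
apply: (@smooth_at_lin _ _ _ (fun u : G => (0 : F, u))) gx.
  by move=> a u v; congr pair; rewrite /= scaler0 addr0.
by move=> u; apply: cvg_pair; [apply: cvg_cst|apply: cvg_id].
Qed.

Lemma smooth_at_fst E F G (x : E) (f : E -> F * G) :
  smooth_at x f -> smooth_at x (fun y => (f y).1).
Proof. by apply: (@smooth_at_lin _ _ _ fst) => // u; apply: cvg_fst. Qed.

Lemma smooth_at_snd E F G (x : E) (f : E -> F * G) :
  smooth_at x f -> smooth_at x (fun y => (f y).2).
Proof. by apply: (@smooth_at_lin _ _ _ snd) => // u; apply: cvg_snd. Qed.

Lemma smooth_at_coord E n (x : E) (f : E -> 'rV[R]_n) j :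
  smooth_at x f -> smooth_at x (fun y => f y 0 j).
Proof.
apply: (@smooth_at_lin _ _ _ (fun u : 'rV[R]_n => u 0 j)).
  by move=> a u v; rewrite !mxE.
exact: coord_continuous.
Qed.

(** A row is the sum of its entries times the basis vectors, so the vector-valued
    case reduces to linear maps. *)
Lemma smooth_at_row E n (x : E) (f : 'I_n -> E -> R) :
  (forall j, smooth_at x (f j)) -> smooth_at x (fun y => \row_j f j y).
Proof.
move=> fx; have -> : (fun y => \row_j f j y) =
    (fun y => \sum_j f j y *: (delta_mx 0 j : 'rV[R]_n)).
  apply/funext => y; rewrite [LHS]row_sum_delta.
  by apply: eq_bigr => j _; rewrite mxE.
apply: smooth_at_sum => j _.
apply: (@smooth_at_lin _ _ _ (fun a : R => a *: (delta_mx 0 j : 'rV[R]_n))) => //.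
  by move=> a u v; rewrite scalerDl scalerA.
exact: scalel_continuous.
Qed.

End SmoothAt.

(** * The characteristic polynomial of an arrow matrix *)

Section ArrowPoly.
Context {K : fieldType} {n : nat}.
Implicit Types (a s : 'I_n -> K) (l : 'I_n.+1 -> K).

(** The characteristic polynomial of an arrow matrix with corner [a0], remaining
    diagonal [a], and [s i] the product of the border entries at [i]. *)
Definition arrow_poly (a0 : K) a s : {poly K} :=
  ('X - a0%:P) * \prod_i ('X - (a i)%:P) -
  \sum_i s i *: \prod_(m | m != i) ('X - (a m)%:P).

Lemma horner_prodXsubC (I : finType) (Q : pred I) (f : I -> K) z :
  (\prod_(m | Q m) ('X - (f m)%:P)).[z] = \prod_(m | Q m) (z - f m).
Proof. by rewrite horner_prod; apply: eq_bigr => m _; rewrite hornerXsubC. Qed.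

Lemma horner_arrow_poly (a0 : K) a s z :
  (arrow_poly a0 a s).[z] =
  (z - a0) * \prod_i (z - a i) - \sum_i s i * \prod_(m | m != i) (z - a m).
Proof.
rewrite /arrow_poly hornerD hornerN hornerM hornerXsubC horner_prodXsubC.
rewrite horner_sum; congr (_ - _).
by apply: eq_bigr => i _; rewrite hornerZ horner_prodXsubC.
Qed.

Lemma horner_arrow_poly_node (a0 : K) a s i z : z = a i ->
  (arrow_poly a0 a s).[z] = - (s i * \prod_(m | m != i) (z - a m)).
Proof.
move=> ->; rewrite horner_arrow_poly (bigD1 i) //= subrr mul0r mulr0 add0r.
rewrite [\sum_j _](bigD1 i) //= [X in _ + X]big1 ?addr0 // => j ji.
by rewrite (bigD1 i) ?(eq_sym i) //= subrr mul0r mulr0.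
Qed.

(** When two diagonal entries collide at [v], the polynomial is divisible by
    ['X - v]; the value of the cofactor at [v] tells whether [v] is a simple
    root. *)
Lemma arrow_poly_double (a0 : K) a s i j v : i != j -> a i = v -> a j = v ->
  exists2 q, arrow_poly a0 a s = ('X - v%:P) * q &
    q.[v] = - ((s i + s j) * \prod_(m | (m != i) && (m != j)) (v - a m)).
Proof.
move=> ij ai aj; have ji : j != i by rewrite eq_sym.
pose r := \prod_(m | (m != i) && (m != j)) ('X - (a m)%:P).
pose t m := \prod_(h | [&& h != i, h != j & h != m]) ('X - (a h)%:P).
exists (('X - a0%:P) * (('X - v%:P) * r) - (s i + s j) *: r
        - ('X - v%:P) * \sum_(m | (m != i) && (m != j)) s m *: t m); last first.
  rewrite !(hornerD, hornerN, hornerM, hornerX, hornerC, hornerZ) subrr.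
  by rewrite !(mul0r, mulr0) add0r oppr0 addr0 horner_prodXsubC.
rewrite /arrow_poly (bigD1 i) //= ai (bigD1 j) //= aj -/r.
rewrite [\sum_i _](bigD1 i) //= [\prod_(m | m != i) _](bigD1 j) //= aj -/r.
rewrite (bigD1 j) //= [\prod_(m | m != j) _](bigD1 i) //= ai.
rewrite (eq_bigl (fun m => (m != i) && (m != j))) -/r; last first.
  by move=> m; rewrite andbC.
have -> : \sum_(m | (m != i) && (m != j))
      s m *: \prod_(h | h != m) ('X - (a h)%:P) =
    ('X - v%:P) ^+ 2 * \sum_(m | (m != i) && (m != j)) s m *: t m.
  rewrite mulr_sumr; apply: eq_bigr => m /andP[mi mj].
  rewrite (bigD1 i) 1?eq_sym //= (bigD1 j) /=; last by rewrite eq_sym mj.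
  rewrite ai aj -scalerAr /t; congr (_ *: _); rewrite expr2 -mulrA.
  congr (_ * (_ * _)); apply: eq_bigl => h.
  by case: (h != i); case: (h != j); case: (h != m).
rewrite -!mul_polyC polyCD; ring.
Qed.

Lemma size_prodXsubC (I : finType) (Q : pred I) (f : I -> K) :
  size (\prod_(m | Q m) ('X - (f m)%:P)) = #|Q|.+1.
Proof.
have -> : \prod_(m | Q m) ('X - (f m)%:P) = \prod_(m <- enum Q) ('X - (f m)%:P).
  by rewrite big_enum.
by rewrite size_prod_XsubC cardE.
Qed.

Lemma size_arrow_poly_tail a s :
  (size (\sum_i s i *: \prod_(m | m != i) ('X - (a m)%:P))%R <= n)%N.
Proof.
apply: (leq_trans (size_sum _ _ _)); apply/bigmax_leqP => i _.
rewrite (leq_trans (size_scale_leq _ _)) // size_prodXsubC.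
by rewrite cardC1 card_ord prednK // (leq_ltn_trans _ (ltn_ord i)).
Qed.

Lemma arrow_poly_headE (a0 : K) a :
  ('X - a0%:P) * \prod_i ('X - (a i)%:P) =
  \prod_(x <- a0 :: codom a) ('X - x%:P).
Proof. by rewrite big_cons big_map enumT. Qed.

Lemma size_arrow_poly_head (a0 : K) a :
  size (('X - a0%:P) * \prod_i ('X - (a i)%:P)) = n.+2.
Proof. by rewrite arrow_poly_headE size_prod_XsubC /= size_codom card_ord. Qed.

Lemma size_arrow_poly (a0 : K) a s : size (arrow_poly a0 a s) = n.+2.
Proof.
rewrite size_polyDl size_arrow_poly_head // size_polyN.
by rewrite ltnS (leq_trans (size_arrow_poly_tail _ _)).
Qed.

Lemma arrow_poly_monic (a0 : K) a s : arrow_poly a0 a s \is monic.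
Proof.
apply/monicP; rewrite lead_coefDl; first last.
  rewrite size_arrow_poly_head size_polyN ltnS.
  by rewrite (leq_trans (size_arrow_poly_tail _ _)).
by rewrite arrow_poly_headE lead_coef_prod_XsubC.
Qed.

Lemma size_spectral_poly l : size (\prod_k ('X - (l k)%:P)) = n.+2.
Proof. by rewrite size_prodXsubC card_ord. Qed.

Lemma coef_arrow_poly (a0 : K) a s :
  (arrow_poly a0 a s)`_n = - (a0 + \sum_i a i).
Proof.
rewrite coefB [X in _ - X]nth_default ?size_arrow_poly_tail // subr0.
have := @coefPn_prod_XsubC K (a0 :: codom a) isT.
rewrite /= size_codom card_ord -arrow_poly_headE => ->.
by rewrite big_cons big_map enumT.
Qed.

Lemma coef_spectral_poly l : (\prod_k ('X - (l k)%:P))`_n = - \sum_k l k.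
Proof.
have := @coefPn_prod_XsubC K (codom l).
by rewrite /= size_codom card_ord !big_image; apply.
Qed.

Lemma arrow_poly_trace (a0 : K) a s l :
  arrow_poly a0 a s = \prod_k ('X - (l k)%:P) ->
  a0 = \sum_k l k - \sum_i a i.
Proof.
move/(congr1 (fun p : {poly K} => p`_n)).
by rewrite /= coef_arrow_poly coef_spectral_poly => /oppr_inj <-; rewrite addrK.
Qed.

(** Both sides are monic of degree [n.+1], so having the [n.+1] distinct roots
    [l k] forces the equality. *)
Lemma arrow_poly_rootsP (a0 : K) a s l : injective l ->
  (forall z, root (arrow_poly a0 a s) z <-> exists i, z = l i) <->
  arrow_poly a0 a s = \prod_k ('X - (l k)%:P).
Proof.
move=> l_inj; split=> [rl|->] => [|z].
  have sz : size (arrow_poly a0 a s) = (size (codom l)).+1.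
    by rewrite size_arrow_poly size_codom card_ord.
  rewrite (all_roots_prod_XsubC sz) ?(monicP (arrow_poly_monic _ _ _)).
  - by rewrite scale1r big_image.
  - by apply/allP => z /codomP [i ->]; apply/rl; exists i.
  - by rewrite uniq_rootsE map_inj_uniq ?enum_uniq.
rewrite rootE horner_prodXsubC; split.
  by move/prodf_eq0 => [k _]; rewrite subr_eq0 => /eqP ->; exists k.
by move=> [k ->]; apply/prodf_eq0; exists k; rewrite ?subrr.
Qed.

(** Hermite interpolation.  The difference of the two sides has degree less than
    [n] by the trace condition, and it vanishes at every [a i], to order two when
    [a i] occurs twice; being divisible by the product of the ['X - a i], it is
    zero. *)
Lemma arrow_poly_interp (a0 : K) a s l :
  a0 = \sum_k l k - \sum_i a i ->
  (forall i, \prod_k (a i - l k) = - (s i * \prod_(m | m != i) (a i - a m))) ->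
  (forall i j, i != j -> a i = a j -> exists2 k, a i = l k &
    \prod_(m | m != k) (a i - l m) =
    - ((s i + s j) * \prod_(m | (m != i) && (m != j)) (a i - a m))) ->
  (forall i j m, i != j -> a j = a i -> m != i -> m != j -> a m != a i) ->
  arrow_poly a0 a s = \prod_k ('X - (l k)%:P).
Proof.
move=> tr single double mult; pose P := \prod_k ('X - (l k)%:P).
set chi := arrow_poly a0 a s; pose D := P - chi.
suff : D = 0 by move/eqP; rewrite subr_eq0 => /eqP.
have szD : (size D <= n)%N.
  (* degree n cancels by the trace condition, degree n + 1 by monicity *)
  apply/leq_sizeP => j; rewrite leq_eqVlt => /orP[/eqP <-|].
    rewrite coefB coef_spectral_poly coef_arrow_poly tr subrK; ring.
  rewrite leq_eqVlt => /orP[/eqP <-|nj].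
    have := lead_coef_prod_XsubC (index_enum 'I_n.+1) xpredT l.
    have := monicP (arrow_poly_monic a0 a s).
    rewrite !lead_coefE size_arrow_poly size_spectral_poly /= => e1 e2.
    by rewrite coefB e1 e2 subrr.
  by rewrite coefB !nth_default ?subrr ?size_spectral_poly ?size_arrow_poly.
have rD i : root D (a i).
  rewrite rootE hornerD hornerN horner_prodXsubC single.
  by rewrite (horner_arrow_poly_node _ _ (erefl (a i))) subrr.
have rD2 i j : i != j -> a j = a i ->
    exists g, D = g * ('X - (a i)%:P) * ('X - (a i)%:P).
  move=> ij aji; have [q qE qv] := arrow_poly_double a0 s ij erefl aji.
  have [k lk Pk] := double i j ij (esym aji).
  have : root (\prod_(m | m != k) ('X - (l m)%:P) - q) (a i).
    by rewrite rootE hornerD hornerN horner_prodXsubC Pk qv subrr.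
  case/factor_theorem => g gE; exists g; rewrite -gE mulrBl /D /P (bigD1 k) //=.
  by rewrite -lk /chi qE mulrC [q * _]mulrC.
have dvd (u : seq 'I_n) : uniq u -> \prod_(i <- u) ('X - (a i)%:P) %| D.
  elim: u => [|i u IH]; first by rewrite big_nil dvd1p.
  rewrite /= => /andP[iu uu]; have /dvdpP[g gE] := IH uu.
  rewrite big_cons gE dvdp_mul2r; last first.
    by rewrite monic_neq0 // monic_prod_XsubC.
  rewrite dvdp_XsubCl.
  have [/hasP[j ju /eqP aji]|/hasPn no] := boolP (has (fun j => a j == a i) u).
    have ij : i != j by apply: contraNneq iu => ->.
    have [h hE] := rD2 i j ij aji.
    have gE' : h * ('X - (a i)%:P) = g * \prod_(y <- rem j u) ('X - (a y)%:P).
      apply: (mulIf (negbT (polyXsubC_eq0 (a i)))).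
      by rewrite -hE gE (big_rem j) //= aji -!mulrA [X in g * X]mulrC.
    have : root (g * \prod_(y <- rem j u) ('X - (a y)%:P)) (a i).
      by rewrite -gE' rootM root_XsubC eqxx orbT.
    rewrite rootM => /orP[] //; rewrite -(big_map a xpredT (fun x => 'X - x%:P)).
    rewrite root_prod_XsubC => /mapP[m]; rewrite mem_rem_uniq // inE => /andP[mj mu] am.
    have mi : m != i by apply: contraNneq iu => <-.
    by have := mult i j m ij aji mi mj; rewrite am eqxx.
  have := rD i; rewrite gE rootM => /orP[] //.
  rewrite -(big_map a xpredT (fun x => 'X - x%:P)) root_prod_XsubC.
  by move=> /mapP[m mu am]; have := no m mu; rewrite am eqxx.
apply/eqP; apply: contraLR szD => D0; rewrite -ltnNge.
have /dvdp_leq := dvd (index_enum 'I_n) (index_enum_uniq _).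
by rewrite size_prodXsubC card_ord; apply.
Qed.

End ArrowPoly.

(** * Eigenvalues of an arrow matrix *)

Section ArrowEigen.
Context {K : fieldType} {n : nat}.

Lemma arrow_mx_eigenP (conj : K -> K) (a : 'rV[K]_n.+1) (b : 'rV[K]_n) z :
  eigenvalue (arrow_mx conj a b) z <->
  exists (v0 : K) (v : 'I_n -> K),
    [/\ v0 != 0 \/ exists i, v i != 0,
        v0 * a 0 0 + \sum_i v i * conj (b 0 i) = z * v0 &
        forall j, v0 * b 0 j + v j * a 0 (lift 0 j) = z * v j].
Proof.
have mulE (w : 'rV[K]_n.+1) :
    (w *m arrow_mx conj a b) 0 0 =
      w 0 0 * a 0 0 + \sum_i w 0 (lift 0 i) * conj (b 0 i) /\
    forall j, (w *m arrow_mx conj a b) 0 (lift 0 j) =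
      w 0 0 * b 0 j + w 0 (lift 0 j) * a 0 (lift 0 j).
  split=> [|j]; rewrite mxE big_ord_recl !mxE ?unlift_none ?liftK; congr (_ + _).
    by apply: eq_bigr => i _; rewrite mxE unlift_none liftK.
  rewrite (bigD1 j) //= mxE !liftK eqxx big1 ?addr0 // => i ij.
  by rewrite mxE !liftK (inj_eq lift_inj) (negbTE ij) mulr0.
split=> [/eigenvalueP[w wE w0]|[v0 [v [v_neq0 E0 E]]]].
  exists (w 0 0), (fun i => w 0 (lift 0 i)); have [M0 M] := mulE w; split.
  - have [w00|] := eqVneq (w 0 0) 0; last by left.
    right; apply/existsP; apply: contraR w0; rewrite negb_exists => /forallP w0.
    apply/eqP/rowP => j; rewrite !mxE; case: (unliftP 0 j) => [i|] -> //.
    by have := w0 i; rewrite negbK => /eqP.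
  - by rewrite -M0 wE mxE.
  - by move=> j; rewrite -M wE mxE.
pose w : 'rV[K]_n.+1 := \row_j if unlift 0 j is Some i then v i else v0.
have wE0 : w 0 0 = v0 by rewrite mxE unlift_none.
have wE i : w 0 (lift 0 i) = v i by rewrite mxE liftK.
apply/eigenvalueP; exists w.
  have [M0 M] := mulE w; apply/rowP => j; rewrite [RHS]mxE.
  case: (unliftP 0 j) => [i|] ->; first by rewrite M wE0 wE E.
  by rewrite M0 wE0 -E0; congr (_ + _); apply: eq_bigr => i _; rewrite wE.
apply/eqP => w0; case: v_neq0 => [|[m]].
  by rewrite -wE0 w0 mxE eqxx.
by rewrite -wE w0 mxE eqxx.
Qed.

(** The equations for an eigenvector [(v0, v)] read
    [v j * (z - a j) = v0 * b j].  If [z] is no [a j], they determine [v] from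
    [v0], and the remaining equation is the vanishing of the polynomial divided
    by the product of the [z - a j].  If [z = a i], the polynomial at [z] is a
    single product, which vanishes iff [b i = 0] (the eigenvector is then the
    basis vector [i]) or some other [a m] equals [z] (it is then a combination of
    the basis vectors [i] and [m]). *)
Lemma eigenvalue_arrow (conj : K -> K) (a : 'rV[K]_n.+1) (b : 'rV[K]_n) z :
  (forall x, (conj x == 0) = (x == 0)) ->
  eigenvalue (arrow_mx conj a b) z <->
  root (arrow_poly (a 0 0) (fun i => a 0 (lift 0 i))
                   (fun i => b 0 i * conj (b 0 i))) z.
Proof.
move=> conj0; apply: (iff_trans (arrow_mx_eigenP _ _ _ _)).
set a0 := a 0 0; set d := fun i => a 0 (lift 0 i).
have prod0 i m : m != i -> d m = z -> \prod_(h | h != i) (z - d h) = 0.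
  by move=> mi dm; apply/eqP/prodf_eq0; exists m => //; rewrite dm subrr.
split=> [[v0 [v [v_neq0 E0 E]]]|].
  have E' j : v0 * b 0 j = v j * (z - d j).
    by rewrite mulrBr [v j * z]mulrC -E addrK.
  have [v00|v00] := eqVneq v0 0.
    case: v_neq0 => [|[i vi]]; first by rewrite v00 eqxx.
    have dE j : v j != 0 -> z = d j.
      move=> vj; have /eqP := E' j; rewrite v00 mul0r eq_sym mulf_eq0 (negbTE vj).
      by rewrite subr_eq0 => /eqP.
    rewrite rootE (horner_arrow_poly_node _ _ (dE i vi)) oppr_eq0 mulf_eq0.
    have [/existsP[m /andP[mi vm]]|] := boolP [exists m, (m != i) && (v m != 0)].
      by rewrite (prod0 i m) ?eqxx ?orbT // -dE.
    rewrite negb_exists => /forallP no; move: E0.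
    rewrite v00 mul0r mulr0 add0r (bigD1 i) //= big1 ?addr0; last first.
      move=> j ji; have := no j; rewrite ji negbK => /eqP ->; exact: mul0r.
    by move=> /eqP; rewrite !mulf_eq0 (negbTE vi) /= => ->; rewrite orbT.
  have [/existsP[i /eqP zi]|] := boolP [exists i, d i == z].
    have /eqP := E' i; rewrite zi subrr mulr0 mulf_eq0 (negbTE v00) /= => /eqP bi.
    by rewrite rootE (horner_arrow_poly_node _ _ (esym zi)) bi !mul0r oppr0.
  rewrite negb_exists => /forallP no.
  have zd i : z - d i != 0 by rewrite subr_eq0 eq_sym no.
  rewrite rootE horner_arrow_poly; apply/eqP/(mulfI v00); rewrite mulr0.
  rewrite mulrBr mulrA mulrBr [v0 * z]mulrC -E0 addrAC subrr add0r.
  rewrite mulr_suml mulr_sumr -sumrB big1 // => i _.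
  rewrite (bigD1 i) //= !mulrA E'; ring.
move=> rz; have [/existsP[i /eqP di]|] := boolP [exists i, d i == z]; last first.
  rewrite negb_exists => /forallP no.
  have zd i : z - d i != 0 by rewrite subr_eq0 eq_sym no.
  exists 1, (fun i => b 0 i / (z - d i)); split.
  - by left; apply: oner_neq0.
  - have q0 : \prod_i (z - d i) != 0 by apply/prodf_neq0 => i _.
    move: rz; rewrite rootE horner_arrow_poly subr_eq0 => /eqP e.
    suff -> : \sum_i b 0 i / (z - d i) * conj (b 0 i) = z - a0.
      by rewrite mul1r mulr1 addrC subrK.
    apply: (mulIf q0); rewrite e mulr_suml; apply: eq_bigr => i _.
    by rewrite (bigD1 i) //=; field; apply: zd.
  - by move=> j; rewrite -/(d j); field; apply: zd.
move: rz; rewrite rootE (horner_arrow_poly_node _ _ (esym di)) oppr_eq0.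
rewrite !mulf_eq0 conj0 orbb => bi_or; pose c := conj \o b 0; exists 0.
have [bi|bi] := eqVneq (b 0 i) 0.
  exists (fun j => (j == i)%:R); split.
  - by right; exists i; rewrite eqxx oner_eq0.
  - rewrite mul0r mulr0 add0r big1 // => j _; case: eqP => [->|_]; rewrite ?mul0r //.
    by apply/eqP; rewrite mul1r conj0 bi.
  - move=> j; rewrite -/(d j); case: eqP => [->|_].
      by rewrite di bi !(mul0r, add0r) mulrC.
    by rewrite !(mul0r, mulr0, add0r).
move: bi_or; rewrite (negbTE bi) /= => /prodf_eq0[m mi].
rewrite subr_eq0 => /eqP dm.
exists (fun j => if j == i then c m else if j == m then - c i else 0); split.
- by right; exists m; rewrite (negbTE mi) eqxx oppr_eq0 conj0.
- rewrite mul0r mulr0 add0r (bigD1 i) //= eqxx (bigD1 m) //= (negbTE mi) eqxx.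
  rewrite big1 ?addr0 => [|j /andP[/negbTE-> /negbTE->]]; last exact: mul0r.
  by rewrite /c /=; ring.
- move=> j; rewrite mul0r add0r -/(d j); case: eqP => [->|_]; first by rewrite di mulrC.
  by case: eqP => [->|_]; rewrite ?mul0r ?mulr0 // [in RHS]dm mulrC.
Qed.

End ArrowEigen.

(** * Explicit charts: the algebra *)

Section ChartAlgebra.
Context {R : realFieldType} {n : nat}.

(** How the index [i] behaves near the matrix around which the chart is built:
    - [Free]: [a i] is not repeated and [b i <> 0];
    - [Vertex k e]: [a i] is not repeated and [b i = 0], so [a i = l k]; the sign
      [e] says on which side of [l k] the entry [a i] moves;
    - [Leader m k], [Follower j k]: the entry is repeated, with [l k] as common
      value, and the other occurrence is at the given index; the leader of a
      pair has [b <> 0]. *)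
Inductive kind :=
  | Free
  | Leader of 'I_n & 'I_n.+1
  | Vertex of 'I_n.+1 & R
  | Follower of 'I_n & 'I_n.+1.

Variable l : 'I_n.+1 -> R.

Definition spec_val (x : R) := \prod_k (x - l k).
Definition cospec_val k (x : R) := \prod_(m | m != k) (x - l m).

Lemma spec_valE k x : spec_val x = (x - l k) * cospec_val k x.
Proof. exact: bigD1. Qed.

Definition isospectral_data (a0 : R) (a s : 'I_n -> R) :=
  arrow_poly a0 a s = \prod_k ('X - (l k)%:P).

Lemma isospectral_node a0 a s i : isospectral_data a0 a s ->
  spec_val (a i) = - (s i * \prod_(m | m != i) (a i - a m)).
Proof.
move/(congr1 (fun p : {poly R} => p.[a i])).
by rewrite /= (horner_arrow_poly_node _ _ (erefl (a i))) horner_prodXsubC.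
Qed.

(** Since [l k] is a simple root when [l] is injective, the left-hand side is then
    nonzero, which is what limits the collisions of diagonal entries. *)
Lemma isospectral_double a0 a s i j k : isospectral_data a0 a s ->
  i != j -> a i = l k -> a j = l k ->
  cospec_val k (l k) =
  - ((s i + s j) * \prod_(m | (m != i) && (m != j)) (l k - a m)).
Proof.
move=> Y ij ai aj; have [q qE qv] := arrow_poly_double a0 s ij ai aj.
rewrite -qv /cospec_val -horner_prodXsubC; congr (_.[_]).
apply: (mulfI (negbT (polyXsubC_eq0 (l k)))).
by rewrite -qE Y [RHS](bigD1 k).
Qed.

Section Chart.
Variables (kd : 'I_n -> kind) (c : 'I_n -> R).

Hypothesis followerP : forall i j k, kd i = Follower j k <-> kd j = Leader i k.
Hypothesis vertexP : forall i k e, kd i = Vertex k e -> e * e = 1.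

Definition partner i :=
  match kd i with Leader m _ => m | Follower m _ => m | _ => i end.

(** The product of the gaps [a i - a m] that stay away from zero on the chart. *)
Definition gap_prod (a : 'I_n -> R) i :=
  \prod_(m | (m != i) && (m != partner i)) (a i - a m).

(** The diagonal as a function of [r i = |z i|^2].  For a follower of [j],
    [c j + r j] is [a j]. *)
Definition chart_diag (r : 'I_n -> R) i :=
  match kd i with
  | Free | Leader _ _ => c i + r i
  | Vertex k e => l k + e * r i
  | Follower j k => l k - (c j + r j - l k) * r i
  end.

(** The value of [s i / r i] forced by [P(a i) = - s i * prod (a i - a m)].  At
    the two members of a pair, both sides contain the factor [a j - l k], for
    [j] the leader (see [chart_pair_diff]); it is cancelled here, so that the
    formula still makes sense where the two diagonal entries collide.  As the
    inverse of zero is zero, positivity of this quantity implies that its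
    denominator is nonzero. *)
Definition chart_scale (r : 'I_n -> R) i :=
  let a := chart_diag r in
  match kd i with
  | Free => - spec_val (a i) / (r i * gap_prod a i)
  | Leader m k => - cospec_val k (a i) / (r i * (1 + r m) * gap_prod a i)
  | Vertex k e => - e * cospec_val k (a i) / gap_prod a i
  | Follower _ k => - cospec_val k (a i) / ((1 + r i) * gap_prod a i)
  end.

(** The inverse of [chart_scale], in terms of [a] and [s] only.  For a follower,
    [1 + r i] has been replaced by its expression
    [- cospec_val k (a j) / (s j * gap_prod a j)] in terms of the leader [j],
    read off from [chart_scale] at [j]. *)
Definition chart_coscale (a s : 'I_n -> R) i :=
  match kd i with
  | Free | Leader _ _ => (a i - c i) / s i
  | Vertex k e => - e * gap_prod a i / cospec_val k (a i)
  | Follower j k => cospec_val k (a j) * gap_prod a i /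
                 (s j * gap_prod a j * cospec_val k (a i))
  end.

Lemma pair_neq i j k : kd i = Follower j k -> i != j.
Proof.
move=> ki; apply/eqP => ij; have := (followerP i j k).1 ki.
by rewrite -ij ki.
Qed.

Lemma gap_prod_pairE a i j k : kd i = Follower j k -> a i = a j ->
  gap_prod a i = gap_prod a j.
Proof.
move=> ki aij; have kj := (followerP i j k).1 ki.
rewrite /gap_prod /partner ki kj aij.
by apply: eq_bigl => m; rewrite andbC.
Qed.

Lemma node_prod_self a i : partner i = i ->
  \prod_(m | m != i) (a i - a m) = gap_prod a i.
Proof. by move=> pi; rewrite /gap_prod pi; apply: eq_bigl => m; rewrite andbb. Qed.

Lemma node_prod_pair a i : partner i != i ->
  \prod_(m | m != i) (a i - a m) = (a i - a (partner i)) * gap_prod a i.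
Proof. by move=> pi; rewrite (bigD1 (partner i)). Qed.

Lemma gap_prod_neq0P a i : gap_prod a i != 0 ->
  forall m, m != i -> m != partner i -> a m != a i.
Proof.
move=> /prodf_neq0 g m mi mp; have := g m; rewrite mi mp => /(_ isT).
by rewrite subr_eq0 eq_sym.
Qed.

Section Forward.
Variable r : 'I_n -> R.
Hypothesis r_ge0 : forall i, 0 <= r i.
Hypothesis H_gt0 : forall i, 0 < chart_scale r i.
Let a := chart_diag r.
Let s i := r i * chart_scale r i.

Lemma one_r_neq0 i : 1 + r i != 0.
Proof. by rewrite gt_eqF // ltr_pwDl. Qed.

Lemma chart_gap_neq0 i : gap_prod a i != 0.
Proof.
have := H_gt0 i; apply: contraTneq => g0; rewrite -leNgt.
by rewrite /chart_scale -/a; case: (kd i) => [|m k|k e|j k]; rewrite g0 ?mulr0 invr0 mulr0.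
Qed.

Lemma chart_r_neq0 i : (kd i = Free \/ exists m k, kd i = Leader m k) -> r i != 0.
Proof.
have := H_gt0 i => + ki; apply: contraTneq => r0; rewrite -leNgt /chart_scale.
by case: ki => [->|[m [k ->]]]; rewrite r0 ?(mul0r, mulr0) invr0 mulr0.
Qed.

(** The two relations that the coordinates at a follower are designed for. *)
Lemma chart_pair_diff i j k : kd i = Follower j k ->
  a i - a j = - ((a j - l k) * (1 + r i)) /\ a i - l k = - ((a j - l k) * r i).
Proof.
move=> ki; have kj := (followerP i j k).1 ki.
by rewrite /a /chart_diag ki kj; split; ring.
Qed.

Lemma chart_node i : spec_val (a i) = - (s i * \prod_(m | m != i) (a i - a m)).
Proof.
have g0 := chart_gap_neq0 i.
case ki: (kd i) => [|m k|k e|j k].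
- rewrite node_prod_self /partner ?ki // /s /chart_scale ki -/a.
  have r0 : r i != 0 by apply: chart_r_neq0; left.
  by field; rewrite g0 r0.
- have km := (followerP m i k).2 ki; have mi := pair_neq km.
  have [d1 d2] := chart_pair_diff km.
  rewrite node_prod_pair /partner ki // /s /chart_scale ki -/a (spec_valE k).
  rewrite -[a i - a m]opprB d1.
  have r0 : r i != 0 by apply: chart_r_neq0; right; exists m, k.
  by field; rewrite g0 r0 one_r_neq0.
- rewrite node_prod_self /partner ?ki // /s /chart_scale ki -/a (spec_valE k).
  have -> : a i - l k = e * r i by rewrite /a /chart_diag ki; ring.
  by field; rewrite g0.
- have ij := pair_neq ki; have [d1 d2] := chart_pair_diff ki.
  rewrite node_prod_pair /partner ki 1?eq_sym // /s /chart_scale ki -/a (spec_valE k).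
  rewrite d1 d2; by field; rewrite g0 one_r_neq0.
Qed.

Lemma chart_double i j k : kd i = Follower j k -> a i = a j ->
  a i = l k /\ cospec_val k (l k) = - ((s i + s j) * gap_prod a i).
Proof.
move=> ki aij; have kj := (followerP i j k).1 ki.
have [d1 d2] := chart_pair_diff ki.
have ajl : a j = l k.
  move: d1 => /eqP; rewrite aij subrr eq_sym oppr_eq0 mulf_eq0.
  by rewrite (negbTE (one_r_neq0 i)) orbF subr_eq0 => /eqP.
split; first by rewrite aij.
have gE := gap_prod_pairE ki aij; have g0 := chart_gap_neq0 j.
have r0 : r j != 0 by apply: chart_r_neq0; right; exists i, k.
rewrite /s /chart_scale ki kj -/a gE aij ajl.
by field; rewrite g0 r0 one_r_neq0.
Qed.

(** The diagonal entries can only collide within a leader-follower pair, so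
    interpolation applies. *)
Lemma chart_isospectral : isospectral_data (\sum_k l k - \sum_i a i) a s.
Proof.
have eqp i j : i != j -> a i = a j -> j = partner i.
  move=> ij aij; apply: contra_eq aij => jp.
  by rewrite eq_sym (gap_prod_neq0P (chart_gap_neq0 i)) // eq_sym.
apply: arrow_poly_interp => // [|i j ij aij|i j m ij aji mi mj].
- exact: chart_node.
- have := eqp i j ij aij; rewrite /partner; case ki: (kd i) => [|m k|k e|m k] jE.
  + by rewrite jE eqxx in ij.
  + subst m; have kj := (followerP j i k).2 ki.
    have [al cE] := chart_double kj (esym aij).
    exists k; first by rewrite aij.
    rewrite aij al -/(cospec_val k (l k)) cE [s i + _]addrC.
    by rewrite /gap_prod /partner kj al; congr (- (_ * _)); apply: eq_bigl => m; rewrite andbC.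
  + by rewrite jE eqxx in ij.
  + subst m; have [al cE] := chart_double ki aij.
    exists k => //; rewrite al -/(cospec_val k (l k)) cE.
    by rewrite /gap_prod /partner ki al.
- have jE := eqp i j ij (esym aji); rewrite jE in mj.
  exact: (gap_prod_neq0P (chart_gap_neq0 i)).
Qed.

Lemma chart_coscaleK i : chart_coscale a s i * chart_scale r i = 1.
Proof.
have H0 : chart_scale r i != 0 by rewrite gt_eqF.
have g0 := chart_gap_neq0 i.
rewrite /chart_coscale; case ki: (kd i) => [|m k|k e|j k].
- have r0 : r i != 0 by apply: chart_r_neq0; left.
  have -> : a i - c i = r i by rewrite /a /chart_diag ki; ring.
  by rewrite /s; field; rewrite r0 H0.
- have r0 : r i != 0 by apply: chart_r_neq0; right; exists m, k.
  have -> : a i - c i = r i by rewrite /a /chart_diag ki; ring.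
  by rewrite /s; field; rewrite r0 H0.
- move: H0; rewrite /chart_scale ki -/a !mulf_eq0 !negb_or => /andP[/andP[e0 p0] _].
  have e1 := vertexP ki.
  transitivity (e * e) => //; by field; rewrite g0 p0.
- have kj := (followerP i j k).1 ki.
  have gj := chart_gap_neq0 j.
  have r0 : r j != 0 by apply: chart_r_neq0; right; exists i, k.
  have H0j : chart_scale r j != 0 by rewrite gt_eqF.
  move: H0 H0j; rewrite /s /chart_scale ki kj -/a !mulf_eq0 !negb_or !oppr_eq0.
  move=> /andP[p0 _] /andP[p0j _].
  by field; rewrite g0 gj p0 p0j r0 one_r_neq0.
Qed.

End Forward.

Section Backward.
Variables (a0 : R) (a s : 'I_n -> R).
Hypothesis Y : isospectral_data a0 a s.
Hypothesis K_gt0 : forall i, 0 < chart_coscale a s i.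
Hypothesis gap_neq0 : forall i, gap_prod a i != 0.
Let r i := s i * chart_coscale a s i.

Lemma backward_leader i : (kd i = Free \/ exists m k, kd i = Leader m k) ->
  [/\ s i != 0, r i = a i - c i & r i != 0].
Proof.
move=> ki; have := K_gt0 i; rewrite /r.
have -> : chart_coscale a s i = (a i - c i) / s i.
  by rewrite /chart_coscale; case: ki => [->|[m [k ->]]].
move=> k0; have s0 : s i != 0.
  by apply: contraTneq k0 => ->; rewrite invr0 mulr0 ltxx.
have ac : a i - c i != 0.
  by apply: contraTneq k0 => ->; rewrite mul0r ltxx.
by rewrite mulrC divfK.
Qed.

(** Where [a i <> a j], the node equations at [i] and [j] give
    [r i = - (a i - l k) / (a j - l k)].  Where they collide they do so at [l k],
    both node equations become trivial, and [isospectral_double] gives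
    [r i = s i / s j] instead. *)
Lemma backward_follower i j k : kd i = Follower j k ->
  [/\ cospec_val k (a i) != 0, cospec_val k (a j) != 0, s j != 0,
   1 + r i = - (cospec_val k (a j) / (s j * gap_prod a j)) &
   a i - l k = - ((a j - l k) * r i)].
Proof.
move=> ki; have kj := (followerP i j k).1 ki; have ij := pair_neq ki.
have [sj _ _] := backward_leader (or_intror (ex_intro _ i (ex_intro _ k kj))).
have := K_gt0 i; rewrite /r /chart_coscale ki => k0.
have pi : cospec_val k (a i) != 0.
  by apply: contraTneq k0 => ->; rewrite mulr0 invr0 mulr0 ltxx.
have pj : cospec_val k (a j) != 0.
  by apply: contraTneq k0 => ->; rewrite !mul0r ltxx.
have [gi gj] := (gap_neq0 i, gap_neq0 j).
have [pti ptj] : partner i = j /\ partner j = i by rewrite /partner ki kj.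
have := isospectral_node i Y; have := isospectral_node j Y.
have ji : j != i by rewrite eq_sym.
rewrite !node_prod_pair ?pti ?ptj // !(spec_valE k) => Yj Yi.
have [aij|aij] := eqVneq (a i) (a j).
  have ail : a i = l k.
    move: Yi => /eqP; rewrite aij subrr mul0r mulr0 oppr0 mulf_eq0 (negbTE pj).
    by rewrite orbF subr_eq0 => /eqP.
  have ajl : a j = l k by rewrite -aij.
  have Yij := isospectral_double Y ij ail ajl.
  have gE := gap_prod_pairE ki aij.
  have Yd : cospec_val k (a i) = - ((s i + s j) * gap_prod a j).
    by rewrite ail Yij -gE /gap_prod /partner ki ail.
  split=> //; last by rewrite ail ajl subrr mul0r oppr0.
  have sij : s i + s j != 0.
    by move: pi; rewrite Yd oppr_eq0 mulf_eq0 negb_or => /andP[].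
  by rewrite gE -aij Yd; field; rewrite sj gj sij.
have dij : a i - a j != 0 by rewrite subr_eq0.
have ajl : a j - l k != 0.
  apply: contra_neqN dij => /eqP ajl; move: Yj.
  by move=> /eqP; rewrite ajl mul0r eq_sym oppr_eq0 !mulf_eq0 (negbTE sj) (negbTE gj)
     orbF /= subr_eq0 => /eqP ->; rewrite subrr.
have pjE : cospec_val k (a j) = s j * (a i - a j) * gap_prod a j / (a j - l k).
  by apply: (mulfI ajl); rewrite Yj; field.
have siE : s i = - ((a i - l k) * cospec_val k (a i)) / ((a i - a j) * gap_prod a i).
  by rewrite Yi; field; rewrite dij gi.
split=> //; rewrite siE pjE.
  by field; rewrite dij gi gj pi sj ajl.
by field; rewrite dij gi gj pi sj ajl.
Qed.

Lemma backward_vertex i k e : kd i = Vertex k e ->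
  cospec_val k (a i) != 0 /\ a i - l k = e * r i.
Proof.
move=> ki; have := K_gt0 i; rewrite /r /chart_coscale ki => k0.
have pi : cospec_val k (a i) != 0.
  by apply: contraTneq k0 => ->; rewrite invr0 mulr0 ltxx.
split=> //; have := isospectral_node i Y.
rewrite node_prod_self /partner ?ki // (spec_valE k) => Yi.
apply: (mulIf pi); rewrite Yi.
have e1 := vertexP ki; transitivity (- (e * e * s i * gap_prod a i)).
  by rewrite e1; ring.
by field.
Qed.

(** The chart recovers the diagonal of an isospectral matrix from
    [r i = s i * chart_coscale a s i]. *)
Lemma backward_diag : chart_diag r = a.
Proof.
apply/funext => i; rewrite /chart_diag; case ki: (kd i) => [|m k|k e|j k].
- have [_ -> _] := backward_leader (or_introl ki); ring.
- have ki' : exists m k, kd i = Leader m k by exists m, k.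
  have [_ -> _] := backward_leader (or_intror ki'); ring.
- by have [_ <-] := backward_vertex ki; ring.
- have [_ _ _ _ e] := backward_follower ki.
  have kj : exists m k, kd j = Leader m k by exists i, k; apply: (followerP i j k).1.
  have [_ -> _] := backward_leader (or_intror kj).
  have -> : c j + (a j - c j) - l k = a j - l k by ring.
  by rewrite -e; ring.
Qed.

Lemma backward_scaleK i : chart_scale r i * chart_coscale a s i = 1.
Proof.
have gi := gap_neq0 i; have := isospectral_node i Y.
rewrite /chart_scale backward_diag; case ki: (kd i) => [|m k|k e|j k].
- rewrite node_prod_self /partner ?ki // => Yi.
  have [si rE r0] := backward_leader (or_introl ki).
  rewrite /chart_coscale ki -rE Yi; field; by rewrite si r0 gi.
- move=> _; have ki' : exists m k, kd i = Leader m k by exists m, k.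
  have [si rE r0] := backward_leader (or_intror ki').
  have km := (followerP m i k).2 ki.
  have [_ pk _ -> _] := backward_follower km.
  by rewrite /chart_coscale ki -rE; field; rewrite si r0 gi pk.
- have [pi _] := backward_vertex ki; have e1 := vertexP ki.
  rewrite /chart_coscale ki => _.
  transitivity (e * e) => //; by field; rewrite gi pi.
- move=> _; have [pi pj sj -> _] := backward_follower ki.
  rewrite /chart_coscale ki; field.
  by rewrite gi pi pj sj gap_neq0.
Qed.

End Backward.
End Chart.
End ChartAlgebra.

(** * A chart around a given isospectral matrix *)

Section ChartExists.
Context {R : realFieldType} {n : nat}.
Variable l : 'I_n.+1 -> R.
Hypothesis l_inj : injective l.

Lemma cospec_val_neq0 k : cospec_val l k (l k) != 0.
Proof.
apply/prodf_neq0 => m mk; rewrite subr_eq0.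
by apply: contraNneq mk => /l_inj ->.
Qed.

Variables (a0 : R) (a s : 'I_n -> R).
Hypothesis Y : isospectral_data l a0 a s.
Hypothesis s_ge0 : forall i, 0 <= s i.

Definition eigen_index i := odflt ord0 [pick k | a i == l k].

Lemma eigen_indexP i : spec_val l (a i) = 0 -> a i = l (eigen_index i).
Proof.
rewrite /eigen_index; case: pickP => [k /eqP //|no] /eqP.
by case/prodf_eq0 => k _; rewrite subr_eq0 no.
Qed.

(** The product in [isospectral_double] is nonzero because [l] is injective: a
    repeated diagonal entry is repeated once, and the two border entries do not
    both vanish. *)
Lemma twinP i j : i != j -> a i = a j ->
  [/\ a i = l (eigen_index i),
      cospec_val l (eigen_index i) (a i) =
        - ((s i + s j) * \prod_(m | (m != i) && (m != j)) (a i - a m)),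
      s i + s j != 0 &
      forall m, m != i -> m != j -> a m != a i].
Proof.
move=> ij aij; set k := eigen_index i.
have ai : a i = l k.
  apply: eigen_indexP; rewrite (isospectral_node i Y) (bigD1 j) 1?eq_sym //=.
  by rewrite aij subrr mul0r mulr0 oppr0.
have aj : a j = l k by rewrite -aij.
have cE := isospectral_double Y ij ai aj.
have := cospec_val_neq0 k; rewrite cE oppr_eq0 mulf_eq0 negb_or.
case/andP=> s0 /prodf_neq0 p0; rewrite ai; split=> // m mi mj.
by have := p0 m; rewrite mi mj subr_eq0 eq_sym; apply.
Qed.

Definition twin i := [pick j | (j != i) && (a j == a i)].

(** Of two twins the one with the larger [s] leads, so that its [s] is nonzero;
    ties are broken by the index. *)
Definition leads i j := (s j < s i) || ((s j == s i) && (j < i)%N).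

Lemma leads_asym i j : i != j -> leads i j = ~~ leads j i.
Proof.
rewrite /leads => ij; case: (ltgtP (s j) (s i)) => //= _.
by rewrite -leqNgt ltn_neqAle -(inj_eq val_inj) /= eq_sym in ij *; rewrite ij.
Qed.

Lemma twin_Some i j : twin i = Some j -> [/\ i != j, a i = a j & twin j = Some i].
Proof.
rewrite /twin; case: pickP => // x /andP[xi /eqP axi] [xj].
rewrite {x}xj in xi axi; have [ji aji] := (xi, axi).
rewrite eq_sym ji aji; split=> //.
case: pickP => [m /andP[mj /eqP am]|no].
  congr Some; apply/eqP; apply: contraT => mi.
  by have [_ _ _ /(_ m mj mi)] := twinP ji aji; rewrite am aji eqxx.
by have := no i; rewrite eq_sym ji eqxx.
Qed.

Lemma twin_None i m : twin i = None -> m != i -> a m != a i.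
Proof.
rewrite /twin; case: pickP => // no _ mi.
by have := no m; rewrite mi => /negbT.
Qed.

Lemma leads_gt0 i j : twin i = Some j -> leads i j -> 0 < s i.
Proof.
move=> ti; have [ij aij _] := twin_Some ti; have [_ _ s0 _] := twinP ij aij.
case/orP=> [|/andP[/eqP sij _]]; first exact: le_lt_trans.
by rewrite lt0r s_ge0 andbT; apply: contraNneq s0 => si0; rewrite sij si0 addr0.
Qed.

(** At a vertex, the sign is chosen so as to make [chart_coscale] positive. *)
Definition base_kind i : kind :=
  match twin i with
  | Some j => if leads i j then Leader j (eigen_index i)
              else Follower j (eigen_index i)
  | None =>
    if s i == 0 then
      Vertex (eigen_index i)
        (- Num.sg (\prod_(m | m != i) (a i - a m) *
                   cospec_val l (eigen_index i) (a i)))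
    else Free
  end.

Definition base_shift i := a i - 1.

Lemma base_followerP i j k :
  base_kind i = Follower j k <-> base_kind j = Leader i k.
Proof.
have idx i' j' : a i' = a j' -> eigen_index i' = eigen_index j'.
  by rewrite /eigen_index => ->.
rewrite /base_kind; split.
  case ti: (twin i) => [m|]; last by case: ifP.
  have [im aim tm] := twin_Some ti.
  case: ifP => // lim [<- <-]; rewrite tm (idx _ _ aim) leads_asym ?lim //.
  by rewrite eq_sym.
case tj: (twin j) => [m|]; last by case: ifP.
have [jm ajm tm] := twin_Some tj.
by case: ifP => // ljm [<- <-]; rewrite tm (idx _ _ ajm) leads_asym ?ljm // eq_sym.
Qed.

Lemma base_partner i j : twin i = Some j -> partner base_kind i = j.
Proof. by move=> ti; rewrite /partner /base_kind ti; case: ifP. Qed.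

Lemma base_partner_None i : twin i = None -> partner base_kind i = i.
Proof. by move=> ti; rewrite /partner /base_kind ti; case: ifP. Qed.

Lemma base_gap_neq0 i : gap_prod base_kind a i != 0.
Proof.
apply/prodf_neq0 => m /andP[mi mp]; rewrite subr_eq0 eq_sym.
case ti: (twin i) => [j|]; last exact: twin_None ti mi.
have [ij aij _] := twin_Some ti; have [_ _ _] := twinP ij aij.
by apply => //; rewrite -(base_partner ti).
Qed.

Lemma base_vertex i k e : base_kind i = Vertex k e ->
  [/\ e = - Num.sg (gap_prod base_kind a i * cospec_val l k (a i)) &
      gap_prod base_kind a i * cospec_val l k (a i) != 0].
Proof.
rewrite {1}/base_kind; case ti: (twin i) => [j|]; first by case: ifP.
case: ifP => // /eqP si [<- <-].
have pi := base_partner_None ti.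
have ai : a i = l (eigen_index i).
  by apply: eigen_indexP; rewrite (isospectral_node i Y) si mul0r oppr0.
rewrite (node_prod_self a pi); split=> //.
by rewrite mulf_neq0 ?base_gap_neq0 // ai cospec_val_neq0.
Qed.

Lemma base_vertexP i k e : base_kind i = Vertex k e -> e * e = 1.
Proof.
by move=> /base_vertex [-> g0]; rewrite mulrNN -expr2 sqr_sg g0.
Qed.

(** At a follower the value is [1 / s j], since [a i = a j] at the base point. *)
Lemma base_coscale_gt0 i : 0 < chart_coscale l base_kind base_shift a s i.
Proof.
have shift1 j : a j - base_shift j = 1 by rewrite /base_shift; ring.
rewrite /chart_coscale; case ki: (base_kind i) => [|m k|k e|j k].
- rewrite shift1 div1r invr_gt0 lt0r s_ge0 andbT.
  move: ki; rewrite /base_kind; case: (twin i) => [?|]; first by case: ifP.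
  by case: ifP => // /negbT.
- rewrite shift1 div1r invr_gt0.
  move: ki; rewrite /base_kind; case ti: (twin i) => [j|]; last by case: ifP.
  by case: ifP => // lij _; apply: leads_gt0 ti lij.
- have [-> g0] := base_vertex ki; move: g0.
  set g := gap_prod _ _ _; set p := cospec_val _ _ _; rewrite opprK.
  rewrite mulf_eq0 negb_or => /andP[g0 p0].
  have -> : Num.sg (g * p) * g / p = `|g * p| / p ^+ 2.
    by rewrite normrEsg; field.
  by rewrite divr_gt0 ?normr_gt0 ?mulf_neq0 // exprn_even_gt0.
- move: (ki); rewrite {1}/base_kind; case ti: (twin i) => [m|]; last by case: ifP.
  case: ifP => // lim [mj kE]; subst m k.
  have [ij aij tj] := twin_Some ti.
  have lji : leads j i by rewrite leads_asym 1?eq_sym // lim.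
  have sj := leads_gt0 tj lji; have gE := gap_prod_pairE base_followerP ki aij.
  have gj := base_gap_neq0 j; have [ai _ _ _] := twinP ij aij.
  have pi := cospec_val_neq0 (eigen_index i); rewrite -ai in pi.
  rewrite gE -aij.
  rewrite (_ : _ / _ = (s j)^-1) ?invr_gt0 //.
  by field; rewrite gt_eqF // gj pi.
Qed.

End ChartExists.

(** * Explicit charts: smoothness *)

Section SmoothChartFunctions.
Context {R : realType} {n : nat}.
Variables (l : 'I_n.+1 -> R) (kd : 'I_n -> @kind R n) (c : 'I_n -> R).

Lemma div_gt0_neq0 (u v : R) : 0 < u / v -> v != 0.
Proof. by apply: contraTneq => ->; rewrite invr0 mulr0 ltxx. Qed.

Variables (E : normedModType R) (x : E).

Section Diag.
Variable a : 'I_n -> E -> R.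
Hypothesis ax : forall i, smooth_at x (a i).

Lemma smooth_gap_prod i : smooth_at x (fun y => gap_prod kd (a ^~ y) i).
Proof. by apply: smooth_at_prod => m _; apply: smooth_atB. Qed.

Lemma smooth_cospec_val k i : smooth_at x (fun y => cospec_val l k (a i y)).
Proof. by apply: smooth_at_prod => m _; apply: smooth_atB => //; apply: smooth_at_cst. Qed.

Lemma smooth_spec_val i : smooth_at x (fun y => spec_val l (a i y)).
Proof. by apply: smooth_at_prod => m _; apply: smooth_atB => //; apply: smooth_at_cst. Qed.

Lemma smooth_chart_coscale (s : 'I_n -> E -> R) i :
  (forall i, smooth_at x (s i)) -> 0 < chart_coscale l kd c (a ^~ x) (s ^~ x) i ->
  smooth_at x (fun y => chart_coscale l kd c (a ^~ y) (s ^~ y) i).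
Proof.
move=> sx; rewrite /chart_coscale; case: (kd i) => [|m k|k e|j k] /div_gt0_neq0 d0.
- apply: smooth_at_div => //; apply: smooth_atB => //; exact: smooth_at_cst.
- apply: smooth_at_div => //; apply: smooth_atB => //; exact: smooth_at_cst.
- apply: smooth_at_div => //; last exact: smooth_cospec_val.
  by apply: smooth_atM; [apply: smooth_at_cst|apply: smooth_gap_prod].
- apply: smooth_at_div => //.
    by apply: smooth_atM; [apply: smooth_cospec_val|apply: smooth_gap_prod].
  apply: smooth_atM; last exact: smooth_cospec_val.
  by apply: smooth_atM => //; apply: smooth_gap_prod.
Qed.
End Diag.

Variable r : 'I_n -> E -> R.
Hypothesis rx : forall i, smooth_at x (r i).

Lemma smooth_chart_diag i : smooth_at x (fun y => chart_diag l kd c (r ^~ y) i).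
Proof.
have cst (u : R) : smooth_at x (fun=> u) by apply: smooth_at_cst.
rewrite /chart_diag; case: (kd i) => [|m k|k e|j k].
- exact: smooth_atD.
- exact: smooth_atD.
- by apply: smooth_atD => //; apply: smooth_atM.
- apply: smooth_atB => //; apply: smooth_atM => //; apply: smooth_atB => //.
  exact: smooth_atD.
Qed.

Lemma smooth_chart_scale i : 0 < chart_scale l kd c (r ^~ x) i ->
  smooth_at x (fun y => chart_scale l kd c (r ^~ y) i).
Proof.
have cst (u : R) : smooth_at x (fun=> u) by apply: smooth_at_cst.
pose a j y := chart_diag l kd c (r ^~ y) j.
have ax j : smooth_at x (a j) by apply: smooth_chart_diag.
have gx := smooth_gap_prod ax i.
have cx k := smooth_cospec_val ax k i.
have px := smooth_spec_val ax i.
rewrite /chart_scale; case: (kd i) => [|m k|k e|j k] /div_gt0_neq0 d0.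
- apply: smooth_at_div => //; first exact: smooth_atN.
  exact: smooth_atM.
- apply: smooth_at_div => //; first by apply: smooth_atN; apply: cx.
  by apply: smooth_atM => //; apply: smooth_atM => //; apply: smooth_atD.
- by apply: smooth_at_div => //; apply: smooth_atM => //; apply: cx.
- apply: smooth_at_div => //; first by apply: smooth_atN; apply: cx.
  by apply: smooth_atM => //; apply: smooth_atD.
Qed.

End SmoothChartFunctions.

(** The border vector [b] lives in [W], either R^n or C^n.  All that matters is
    [nsq i b = |b_i|^2] and the coordinatewise multiplication [sc] by real
    numbers. *)
Section GenericChart.
Context {R : realType} {W : normedModType R} {n : nat}.
Variables (nsq : 'I_n -> W -> R) (sc : ('I_n -> R) -> W -> W).
Hypothesis nsq_ge0 : forall i w, 0 <= nsq i w.
Hypothesis smooth_nsq : forall (E : normedModType R) (x : E) (f : E -> W) i,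
  smooth_at x f -> smooth_at x (fun y => nsq i (f y)).
Hypothesis smooth_sc : forall (E : normedModType R) (x : E) (h : 'I_n -> E -> R)
    (f : E -> W), (forall i, smooth_at x (h i)) -> smooth_at x f ->
  smooth_at x (fun y => sc (h ^~ y) (f y)).
Hypothesis nsq_sc : forall i h w, nsq i (sc h w) = h i ^+ 2 * nsq i w.
Hypothesis scA : forall h h' w, sc h (sc h' w) = sc (fun i => h i * h' i) w.
Hypothesis sc1 : forall w, sc (fun=> 1) w = w.

Local Notation E := ('rV[R]_n.+1 * W)%type.

Variable l : 'I_n.+1 -> R.
Hypothesis l_inj : injective l.

Definition diag_of (y : E) i := y.1 0 (lift 0 i).
Definition sqr_of (y : E) i := nsq i y.2.

Definition isospectral_set : set E :=
  [set y : E | isospectral_data l (y.1 0 0) (diag_of y) (sqr_of y)].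

Section Chart.
Variables (kd : 'I_n -> @kind R n) (c : 'I_n -> R).
Hypothesis followerP : forall i j k, kd i = Follower j k <-> kd j = Leader i k.
Hypothesis vertexP : forall i k e, kd i = Vertex k e -> e * e = 1.

Definition coscale_of (y : E) := chart_coscale l kd c (diag_of y) (sqr_of y).
Definition scale_of (z : W) := chart_scale l kd c (nsq ^~ z).

(** Positivity also keeps the denominators nonzero, which makes both sets
    open. *)
Definition chart_dom : set E :=
  [set y : E | forall i, 0 < coscale_of y i /\ gap_prod kd (diag_of y) i != 0].
Definition chart_cod : set W := [set z | forall i, 0 < scale_of z i].

(** Square roots, because [nsq] is quadratic in [sc]. *)
Definition chart_fun (y : E) : W := sc (fun i => Num.sqrt (coscale_of y i)) y.2.
Definition chart_inv (z : W) : E :=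
  let a := chart_diag l kd c (nsq ^~ z) in
  (\row_j (if unlift 0 j is Some i then a i else \sum_k l k - \sum_i a i),
   sc (fun i => Num.sqrt (scale_of z i)) z).

Lemma smooth_diag_of (y : E) i : smooth_at y (fun y : E => diag_of y i).
Proof. by apply: smooth_at_coord; apply: smooth_at_fst; apply: smooth_at_id. Qed.

Lemma smooth_sqr_of (y : E) i : smooth_at y (fun y : E => sqr_of y i).
Proof. by apply: smooth_nsq; apply: smooth_at_snd; apply: smooth_at_id. Qed.

Lemma smooth_coscale_of (y : E) i : 0 < coscale_of y i ->
  smooth_at y (fun y : E => coscale_of y i).
Proof.
apply: (@smooth_chart_coscale _ _ _ _ _ _ _ (fun i (y : E) => diag_of y i) _
         (fun i (y : E) => sqr_of y i)).
  by move=> j; apply: smooth_diag_of.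
by move=> j; apply: smooth_sqr_of.
Qed.

Lemma smooth_nsq_id (z : W) i : smooth_at z (nsq i).
Proof. by apply: smooth_nsq; apply: smooth_at_id. Qed.

Lemma smooth_scale_of (z : W) i : 0 < scale_of z i -> smooth_at z (fun z => scale_of z i).
Proof.
by apply: (@smooth_chart_scale _ _ _ _ _ _ _ nsq) => j; apply: smooth_nsq_id.
Qed.

Lemma near_open (F : normedModType R) (y : F) (f : F -> R) (B : set R) :
  open B -> smooth_at y f -> B (f y) -> \near y, B (f y).
Proof.
move=> oB /smooth_at_continuous fy By; apply: fy; exact: open_nbhs_nbhs.
Qed.

Lemma chart_dom_open : open chart_dom.
Proof.
rewrite openE => y yU.
suff : \forall y' \near y, forall i,
    0 < coscale_of y' i /\ gap_prod kd (diag_of y') i != 0 by [].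
apply: (@filter_forall _ _ (fun i (y' : E) =>
  0 < coscale_of y' i /\ gap_prod kd (diag_of y') i != 0) (nbhs y) _) => i.
have [K0 g0] := yU i.
have Knear := near_open (@open_gt R 0) (smooth_coscale_of K0) K0.
have gy : smooth_at y (fun y : E => gap_prod kd (diag_of y) i).
  apply: (@smooth_gap_prod _ _ _ _ _ (fun i (y : E) => diag_of y i)) => j.
  exact: smooth_diag_of.
have gnear := near_open (@open_neq R 0) gy g0.
by apply: filterS2 Knear gnear.
Qed.

Lemma chart_cod_open : open chart_cod.
Proof.
rewrite openE => z zD.
suff : \forall z' \near z, forall i, 0 < scale_of z' i by [].
apply: (@filter_forall _ _ (fun i (z' : W) => 0 < scale_of z' i) (nbhs z) _) => i.
exact: (near_open (@open_gt R 0) (smooth_scale_of (zD i)) (zD i)).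
Qed.

Lemma nsq_chart_fun (y : E) : chart_dom y ->
  nsq ^~ (chart_fun y) = fun i => sqr_of y i * coscale_of y i.
Proof.
move=> yU; apply/funext => i; have [K0 _] := yU i.
by rewrite nsq_sc sqr_sqrtr 1?ltW // mulrC.
Qed.

Lemma sqr_of_chart_inv z : chart_cod z ->
  sqr_of (chart_inv z) = fun i => nsq i z * scale_of z i.
Proof.
by move=> zD; apply/funext => i; rewrite /sqr_of nsq_sc sqr_sqrtr 1?ltW // mulrC.
Qed.

Lemma diag_of_chart_inv z :
  diag_of (chart_inv z) = chart_diag l kd c (nsq ^~ z).
Proof. by apply/funext => i; rewrite /diag_of mxE liftK. Qed.

Lemma sc_sqrtK (h h' : 'I_n -> R) w : (forall i, 0 < h i) ->
  (forall i, h i * h' i = 1) ->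
  sc (fun i => Num.sqrt (h i)) (sc (fun i => Num.sqrt (h' i)) w) = w.
Proof.
move=> h0 hh'; rewrite scA -[RHS]sc1; congr sc; apply/funext => i.
by rewrite -sqrtrM ?hh' ?sqrtr1 // ltW.
Qed.

Lemma chart_funK (y : E) : (isospectral_set `&` chart_dom) y ->
  chart_cod (chart_fun y) /\ chart_inv (chart_fun y) = y.
Proof.
case=> yM yU; have nE := nsq_chart_fun yU.
have K0 i := (yU i).1; have g0 i := (yU i).2.
have aE := backward_diag followerP vertexP yM K0 g0.
have HK i := backward_scaleK followerP vertexP yM K0 g0 i.
have sE : scale_of (chart_fun y) =
    chart_scale l kd c (fun i => sqr_of y i * coscale_of y i).
  by rewrite /scale_of nE.
have H0 i : 0 < scale_of (chart_fun y) i.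
  by rewrite sE -(pmulr_lgt0 _ (K0 i)) HK.
split=> //; rewrite /chart_inv nE aE [RHS]surjective_pairing; congr pair.
  apply/rowP => j; rewrite mxE; case: (unliftP 0 j) => [i|] -> //.
  by rewrite (arrow_poly_trace yM).
by apply: sc_sqrtK => // i; rewrite sE HK.
Qed.

Lemma chart_invK z : chart_cod z ->
  (isospectral_set `&` chart_dom) (chart_inv z) /\ chart_fun (chart_inv z) = z.
Proof.
move=> zD; have nE := sqr_of_chart_inv zD; have aE := diag_of_chart_inv z.
have r0 i := nsq_ge0 i z.
have KH i := chart_coscaleK followerP vertexP r0 zD i.
have K0 i : 0 < coscale_of (chart_inv z) i.
  by rewrite /coscale_of nE aE -(pmulr_lgt0 _ (zD i)) KH.
split; last by apply: sc_sqrtK => // i; rewrite /coscale_of nE aE KH.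
split=> [|i].
  rewrite /isospectral_set /= nE aE mxE unlift_none.
  exact: chart_isospectral.
by split=> //; rewrite aE; apply: chart_gap_neq0.
Qed.

Lemma chart_diffeo :
  diffeo (isospectral_set `&` chart_dom) chart_cod chart_fun chart_inv.
Proof.
split; [exact: chart_funK|exact: chart_invK|apply: smooth_at_on..].
  move=> y [_ yU]; apply: smooth_sc; last first.
    by apply: smooth_at_snd; apply: smooth_at_id.
  by move=> i; have [K0 _] := yU i; apply: smooth_at_sqrt => //; apply: smooth_coscale_of.
move=> z zD.
have ax i : smooth_at z (fun z => chart_diag l kd c (nsq ^~ z) i).
  by apply: smooth_chart_diag => j; apply: smooth_nsq_id.
apply: smooth_at_pair.
  apply: smooth_at_row => j; case: (unlift 0 j) => [i|]; first exact: ax.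
  apply: smooth_atB; first exact: smooth_at_cst.
  by apply: smooth_at_sum => i _; apply: ax.
apply: smooth_sc; last exact: smooth_at_id.
by move=> i; apply: smooth_at_sqrt; [apply: zD|apply: smooth_scale_of (zD i)].
Qed.

(** Everything in a chart is expressed by [nsq] and [sc], hence commutes with the
    maps [tau] that respect both. *)
Variable tau : W -> W.
Hypothesis nsq_tau : forall i w, nsq i (tau w) = nsq i w.
Hypothesis sc_tau : forall h w, sc h (tau w) = tau (sc h w).

Lemma sqr_of_tau y : sqr_of (y.1, tau y.2) = sqr_of y.
Proof. by apply/funext => i; apply: nsq_tau. Qed.

Lemma chart_set_tau y : (isospectral_set `&` chart_dom) y ->
  (isospectral_set `&` chart_dom) (y.1, tau y.2).
Proof.
case=> yM yU; split; first by rewrite /isospectral_set /= sqr_of_tau.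
by move=> i; rewrite /coscale_of sqr_of_tau; apply: yU.
Qed.

Lemma chart_cod_tau z : chart_cod z -> chart_cod (tau z).
Proof.
have -> // : chart_cod (tau z) = chart_cod z.
by rewrite /chart_cod /scale_of /=; under eq_fun do rewrite nsq_tau.
Qed.

Lemma chart_fun_tau y : chart_fun (y.1, tau y.2) = tau (chart_fun y).
Proof. by rewrite /chart_fun /coscale_of sqr_of_tau sc_tau. Qed.

End Chart.

Theorem isospectral_chart x : isospectral_set x ->
  exists (U : set E) (D : set W) (f : E -> W) (g : W -> E),
    [/\ rel_open isospectral_set U, U x, open D, diffeo U D f g &
      forall tau : W -> W, (forall i w, nsq i (tau w) = nsq i w) ->
        (forall h w, sc h (tau w) = tau (sc h w)) ->
        [/\ forall y, U y -> U (y.1, tau y.2),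
            forall z, D z -> D (tau z) &
            forall y, f (y.1, tau y.2) = tau (f y)]].
Proof.
move=> xM; have xY : isospectral_data l (x.1 0 0) (diag_of x) (sqr_of x) by [].
have s0 i : 0 <= sqr_of x i by apply: nsq_ge0.
pose kd := base_kind l (diag_of x) (sqr_of x).
pose c := base_shift (diag_of x).
have foP : forall i j k, kd i = Follower j k <-> kd j = Leader i k.
  exact: (base_followerP l_inj xY).
have veP : forall i k e, kd i = Vertex k e -> e * e = 1.
  move=> i k e; exact: (base_vertexP l_inj xY).
exists (isospectral_set `&` chart_dom kd c), (chart_cod kd c).
exists (chart_fun kd c), (chart_inv kd c); split.
- by exists (chart_dom kd c) => //; apply: chart_dom_open.
- split=> // i; split; first exact: (base_coscale_gt0 l_inj xY).
  exact: (base_gap_neq0 l_inj xY).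
- exact: chart_cod_open.
- exact: chart_diffeo.
- move=> tau nt st; split.
  + by move=> y; apply: chart_set_tau.
  + by move=> z; apply: chart_cod_tau.
  + by move=> y; apply: chart_fun_tau.
Qed.

End GenericChart.

(** * From charts to locally standard actions *)

Section Transport.
Context {R : realType}.

(** Allows a chart with values in [W] to be read in R^d, for a linear isomorphism
    [W = R^d]. *)
Lemma diffeo_linear (E W W' : normedModType R) (U : set E) (D : set W)
    (f : E -> W) (g : W -> E) (L : W -> W') (L' : W' -> W) :
  linear L -> continuous L -> linear L' -> continuous L' ->
  cancel L L' -> cancel L' L ->
  diffeo U D f g -> diffeo U (L' @^-1` D) (L \o f) (g \o L').
Proof.
move=> linL cL linL' cL' LK L'K [fK gK sf sg].
pose l : {linear W -> W'} := HB.pack L (GRing.isLinear.Build _ _ _ _ _ linL).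
pose l' : {linear W' -> W} := HB.pack L' (GRing.isLinear.Build _ _ _ _ _ linL').
split.
- by move=> x /fK [Dx gfx]; rewrite /= LK.
- by move=> y /gK [Ux fgx]; rewrite /= fgx L'K.
- move=> x /sf [V [h [oV Vx hC hE]]]; exists V, (L \o h); split=> //.
    by move=> k; apply: (@Ck_lin _ _ _ _ k V l).
  by move=> y Uy Vy; rewrite /= hE.
- move=> x /sg [V [h [oV Vx hC hE]]]; exists (L' @^-1` V), (h \o L'); split=> //.
  + exact: open_comp.
  + by move=> k; apply: (@Ck_precomp _ _ _ _ k V l').
  + by move=> y Uy Vy; rewrite /= hE.
Qed.

End Transport.

(** The group [G] acts on the border [b] through a homomorphism [phi] onto [H],
    with kernel [N] and with a continuous section [sec].  The charts are already
    equivariant for [H]; the section is what makes the topology of [H] the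
    quotient topology. *)
Section GenericAction.
Context {R : realType} {V W : normedModType R} {n : nat}.
Variables (nsq : 'I_n -> W -> R) (sc : ('I_n -> R) -> W -> W).
Hypothesis nsq_ge0 : forall i w, 0 <= nsq i w.
Hypothesis smooth_nsq : forall (E : normedModType R) (x : E) (f : E -> W) i,
  smooth_at x f -> smooth_at x (fun y => nsq i (f y)).
Hypothesis smooth_sc : forall (E : normedModType R) (x : E) (h : 'I_n -> E -> R)
    (f : E -> W), (forall i, smooth_at x (h i)) -> smooth_at x f ->
  smooth_at x (fun y => sc (h ^~ y) (f y)).
Hypothesis nsq_sc : forall i h w, nsq i (sc h w) = h i ^+ 2 * nsq i w.
Hypothesis scA : forall h h' w, sc h (sc h' w) = sc (fun i => h i * h' i) w.
Hypothesis sc1 : forall w, sc (fun=> 1) w = w.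

Variable l : 'I_n.+1 -> R.
Hypothesis l_inj : injective l.

Local Notation E := ('rV[R]_n.+1 * W)%type.
Local Notation M := (isospectral_set nsq l).

Variables (mulV : V -> V -> V) (oneV : V) (G N : set V).
Variables (mulW : W -> W -> W) (oneW : W) (H : set W).
Variables (act : V -> E -> E) (phi : V -> W) (sec : W -> V).

Hypothesis G1 : G oneV.
Hypothesis GM : forall s t, G s -> G t -> G (mulV s t).
Hypothesis NG : N `<=` G.
Hypothesis phiH : forall t, G t -> H (phi t).
Hypothesis phi1 : phi oneV = oneW.
Hypothesis phiM : forall s t, G s -> G t -> phi (mulV s t) = mulW (phi s) (phi t).
Hypothesis phiN : forall s t, G s -> G t ->
  (phi s = phi t <-> exists2 u, N u & s = mulV u t).
Hypothesis mul1V : forall t, mulV t oneV = t.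
Hypothesis mul1W : forall w, mulW oneW w = w.
Hypothesis mulWA : forall u v w, mulW u (mulW v w) = mulW (mulW u v) w.
Hypothesis secG : forall h, H h -> G (sec h).
Hypothesis secK : forall h, H h -> phi (sec h) = h.
Hypothesis sec_continuous : continuous sec.
Hypothesis smooth_phi : forall (F : normedModType R) (x : F) (f : F -> V),
  smooth_at x f -> smooth_at x (fun y => phi (f y)).
Hypothesis smooth_mulW : forall (F : normedModType R) (x : F) (f g : F -> W),
  smooth_at x f -> smooth_at x g -> smooth_at x (fun y => mulW (f y) (g y)).
Hypothesis actE : forall t x, G t -> act t x = (x.1, mulW (phi t) x.2).
Hypothesis nsq_mul : forall i h w, H h -> nsq i (mulW h w) = nsq i w.
Hypothesis sc_mul : forall k h w, sc k (mulW h w) = mulW h (sc k w).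

Lemma isospectral_act t x : G t -> M x -> M (act t x).
Proof.
move=> Gt xM; rewrite actE // /isospectral_set /=.
rewrite (_ : sqr_of nsq _ = sqr_of nsq x) //.
by apply/funext => i; rewrite /sqr_of nsq_mul //; apply: phiH.
Qed.

Lemma isospectral_smooth_action : smooth_action mulV oneV G N act M.
Proof.
split.
- exact: isospectral_act.
- by move=> x _; rewrite actE // phi1 mul1W -surjective_pairing.
- by move=> s t x Gs Gt _; rewrite !actE ?phiM ?mulWA //; apply: GM.
- move=> t x Nt _; have Gt := NG Nt.
  have : phi t = phi oneV by apply/phiN => //; exists t.
  by rewrite actE // => ->; rewrite phi1 mul1W -surjective_pairing.
move=> p _; have [U [oU Up gC]] : smooth_at p
    (fun p : V * E => (p.2.1, mulW (phi p.1) p.2.2)).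
  apply: smooth_at_pair.
    by apply: smooth_at_fst; apply: smooth_at_snd; apply: smooth_at_id.
  apply: smooth_mulW.
    by apply: smooth_phi; apply: smooth_at_fst; apply: smooth_at_id.
  by do 2!apply: smooth_at_snd; apply: smooth_at_id.
exists U, (fun p : V * E => (p.2.1, mulW (phi p.1) p.2.2)); split=> //.
by move=> q [Gq _] _; rewrite actE.
Qed.

Lemma phi_continuous : continuous phi.
Proof.
move=> t; apply: smooth_at_continuous; apply: (smooth_phi (f := id)).
exact: smooth_at_id.
Qed.

Lemma phi_quotient_iso : quotient_iso mulV G N mulW H phi.
Proof.
split=> //.
- rewrite eqEsubset; split=> [_ [t Gt <-]|h Hh]; first exact: phiH.
  by exists (sec h); [apply: secG|apply: secK].
- move=> B BH; split=> -[U oU BE].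
    exists (phi @^-1` U); first by apply: open_comp => // t _; apply: phi_continuous.
    rewrite BE eqEsubset; split=> t [Gt] => [[_ Ut]|Ut]; split=> //.
    by split=> //; apply: phiH.
  exists (sec @^-1` U); first exact: open_comp.
  rewrite eqEsubset; split=> h.
    move=> Bh; have Hh := BH _ Bh; split=> //.
    have : (G `&` phi @^-1` B) (sec h).
      by split; [apply: secG|rewrite /preimage /= secK].
    by rewrite BE => -[].
  move=> [Hh Uh]; have : (G `&` U) (sec h) by split=> //; apply: secG.
  by rewrite -BE => -[_] /=; rewrite secK.
Qed.

Theorem isospectral_locally_standard :
  locally_standard mulV oneV G N mulW H act M.
Proof.
split; first exact: isospectral_smooth_action.
move=> x xM.
have [U [D [f [g [rU Ux oD fg tauP]]]]] :=
  isospectral_chart nsq_ge0 smooth_nsq smooth_sc nsq_sc scA sc1 l_inj xM.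
have tau h (Hh : H h) := tauP (mulW h) (fun i w => nsq_mul i w Hh)
  (fun k w => sc_mul k h w).
exists U, D, phi, f, g; split=> //.
- split=> // t y Gt Uy; rewrite actE //.
  by have [UP _ _] := tau _ (phiH Gt); apply: UP.
- by split=> // h z Hh Dz; have [_ DP _] := tau _ Hh; apply: DP.
- exact: phi_quotient_iso.
- move=> t y Gt Uy; rewrite actE //.
  by have [_ _ fP] := tau _ (phiH Gt); apply: fP.
Qed.

End GenericAction.

(** * Real symmetric arrow matrices *)

Section Spectrum.

Lemma map_arrow_poly (K L : fieldType) (f : {rmorphism K -> L}) n (a0 : K)
    (a s : 'I_n -> K) :
  map_poly f (arrow_poly a0 a s) = arrow_poly (f a0) (f \o a) (f \o s).
Proof.
rewrite /arrow_poly rmorphB rmorphM /= map_polyXsubC rmorph_prod rmorph_sum.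
congr (_ * _ - _); first by apply: eq_bigr => i _; rewrite /= map_polyXsubC.
apply: eq_bigr => i _; rewrite /= map_polyZ rmorph_prod /=; congr (_ *: _).
by apply: eq_bigr => m _; rewrite /= map_polyXsubC.
Qed.

Lemma has_spectrum_arrow (K : fieldType) (conj : K -> K) n (a : 'rV[K]_n.+1)
    (b : 'rV[K]_n) (l : 'I_n.+1 -> K) :
  (forall x, (conj x == 0) = (x == 0)) -> injective l ->
  has_spectrum (arrow_mx conj a b) l <->
  arrow_poly (a 0 0) (fun i => a 0 (lift 0 i)) (fun i => b 0 i * conj (b 0 i)) =
    \prod_k ('X - (l k)%:P).
Proof.
move=> conj0 l_inj; apply: iff_trans (arrow_poly_rootsP _ _ _ l_inj).
split=> sp z.
  by apply: iff_trans (sp z); apply: iff_sym; apply: eigenvalue_arrow.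
by apply: iff_trans (sp z); apply: eigenvalue_arrow.
Qed.

End Spectrum.

Section RealCase.
Context {R : realType} {n : nat}.
Local Notation W := 'rV[R]_n.

Definition real_sqr (i : 'I_n) (w : W) : R := w 0 i ^+ 2.
Definition real_scale (h : 'I_n -> R) (w : W) : W := \row_j (h j * w 0 j).

Lemma real_sqr_ge0 i w : 0 <= real_sqr i w.
Proof. exact: sqr_ge0. Qed.

Lemma smooth_real_sqr (E : normedModType R) (x : E) (f : E -> W) i :
  smooth_at x f -> smooth_at x (fun y => real_sqr i (f y)).
Proof. by move=> fx; apply: smooth_atM; apply: smooth_at_coord. Qed.

Lemma smooth_real_scale (E : normedModType R) (x : E) (h : 'I_n -> E -> R)
    (f : E -> W) : (forall i, smooth_at x (h i)) -> smooth_at x f ->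
  smooth_at x (fun y => real_scale (h ^~ y) (f y)).
Proof.
move=> hx fx; apply: smooth_at_row => j.
by apply: smooth_atM => //; apply: smooth_at_coord.
Qed.

Lemma real_sqr_scale i h w : real_sqr i (real_scale h w) = h i ^+ 2 * real_sqr i w.
Proof. by rewrite /real_sqr mxE exprMn. Qed.

Lemma real_scaleA h h' w :
  real_scale h (real_scale h' w) = real_scale (fun i => h i * h' i) w.
Proof. by apply/rowP => j; rewrite !mxE mulrA. Qed.

Lemma real_scale1 w : real_scale (fun=> 1) w = w.
Proof. by apply/rowP => j; rewrite !mxE mul1r. Qed.

(** Conjugation by [t] multiplies the border entry [j] by [t_0 / t_j], and signs
    are their own inverses. *)
Definition sign_ratio (t : 'rV[R]_n.+1) : W := \row_j (t 0 0 * t 0 (lift 0 j)).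
Definition sign_section (h : W) : 'rV[R]_n.+1 :=
  \row_j (if unlift 0 j is Some i then h 0 i else 1).

Lemma signsE m (t : 'rV[R]_m) : signs R m t <-> forall j, t 0 j ^+ 2 = 1.
Proof.
split=> tS j; first by case: (tS j) => ->; rewrite ?sqrrN expr1n.
by have /eqP := tS j; rewrite sqrf_eq1 => /orP[] /eqP; [left|right].
Qed.

Variable l : 'I_n.+1 -> R.
Hypothesis l_inj : injective l.

Lemma symm_isospectralE : symm_isospectral l = isospectral_set real_sqr l.
Proof.
apply/seteqP; split=> x.
  move=> [A [AA AS] <-]; move: AS; rewrite -{1}(symm_coordK AA).
  by rewrite /symm_mx has_spectrum_arrow.
move=> xM; exists (symm_mx x); last exact: symm_mxK.
split; first exact: symm_mx_arrow.
by rewrite /symm_mx has_spectrum_arrow.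
Qed.

Lemma symm_act_ratio t x : signs R n.+1 t ->
  symm_act t x = (x.1, rmul (sign_ratio t) x.2).
Proof.
move=> tS; have t0 k : t 0 k != 0.
  by case: (tS k) => ->; rewrite ?oppr_eq0 oner_eq0.
have tV k : (t 0 k)^-1 = t 0 k by case: (tS k) => ->; rewrite ?invrN invr1.
rewrite /symm_act /symm_coord; congr pair; apply/rowP => j.
  rewrite mxE conj_diag_mxE // mxE.
  case: (unliftP 0 j) => [i|] ->; rewrite ?eqxx; by rewrite mulrAC mulfV ?mul1r.
by rewrite [LHS]mxE conj_diag_mxE // !mxE unlift_none liftK tV mulrAC.
Qed.

Theorem symm_locally_standard :
  locally_standard rmul rone (signs R n.+1) (scalar_signs R n.+1)
        rmul (signs R n) symm_act (symm_isospectral l).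
Proof.
rewrite symm_isospectralE.
apply: (@isospectral_locally_standard _ _ _ _ real_sqr real_scale real_sqr_ge0
  smooth_real_sqr smooth_real_scale real_sqr_scale real_scaleA real_scale1 _
  l_inj _ _ _ _ _ rone _ _ sign_ratio sign_section).
- by move=> j; left; rewrite mxE.
- move=> s t /signsE Gs /signsE Gt; apply/signsE => j.
  by rewrite mxE exprMn Gs Gt mulr1.
- by move=> t [].
- by move=> t /signsE Gt; apply/signsE => j; rewrite mxE exprMn !Gt mulr1.
- by apply/rowP => j; rewrite !mxE mulr1.
- by move=> s t _ _; apply/rowP => j; rewrite !mxE mulrACA.
- move=> s t /signsE Gs /signsE Gt; split.
    (* the scalar s_0 / t_0 carries t to s *)
    move=> /rowP st; exists (const_mx (s 0 0 * t 0 0)).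
      split; last by exists (s 0 0 * t 0 0).
      by apply/signsE => j; rewrite mxE exprMn Gs Gt mulr1.
    apply/rowP => j; rewrite !mxE.
    case: (unliftP 0 j) => [i|] ->; last by rewrite -mulrA -expr2 Gt mulr1.
    have := st i; rewrite !mxE => e.
    by rewrite -mulrA -e mulrA -expr2 Gs mul1r.
  move=> [u [/signsE Gu [k uE]] ->]; apply/rowP => j; rewrite !mxE.
  have := Gu 0; rewrite uE !mxE expr2 => kk.
  by rewrite mulrACA kk mul1r.
- by move=> t; apply/rowP => j; rewrite !mxE mulr1.
- by move=> w; apply/rowP => j; rewrite !mxE mul1r.
- by move=> u v w; apply/rowP => j; rewrite !mxE mulrA.
- move=> h /signsE Hh; apply/signsE => j; rewrite mxE.
  by case: (unlift 0 j) => [i|]; rewrite ?Hh ?expr1n.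
- move=> h Hh; apply/rowP => j; rewrite !mxE unlift_none liftK mul1r //.
- move=> h; apply: smooth_at_continuous; apply: smooth_at_row => j.
  case: (unlift 0 j) => [i|]; last exact: smooth_at_cst.
  by apply: smooth_at_coord; apply: smooth_at_id.
- move=> F x f fx; apply: smooth_at_row => j.
  by apply: smooth_atM; apply: smooth_at_coord.
- move=> F x f g fx gx; apply: smooth_at_row => j.
  by apply: smooth_atM; apply: smooth_at_coord.
- exact: symm_act_ratio.
- by move=> i h w /signsE Hh; rewrite /real_sqr mxE exprMn Hh mul1r.
- by move=> k h w; apply/rowP => j; rewrite !mxE mulrCA.
Qed.

Theorem symm_smooth_manifold : smooth_manifold n (symm_isospectral l).
Proof.
rewrite symm_isospectralE => x xM.
have [U [D [f [g [rU Ux oD fg _]]]]] := isospectral_chart real_sqr_ge0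
  smooth_real_sqr smooth_real_scale real_sqr_scale real_scaleA real_scale1 l_inj xM.
by exists U, D, f, g.
Qed.

End RealCase.

(** * Hermitian arrow matrices *)

Section ComplexCase.
Local Open Scope complex_scope.
Context {R : realType} {n : nat}.
Local Notation W := (Cspace R n).

Definition complex_sqr m (i : 'I_m) (w : Cspace R m) : R :=
  w.1 0 i ^+ 2 + w.2 0 i ^+ 2.
Definition complex_scale (h : 'I_n -> R) (w : W) : W :=
  (real_scale h w.1, real_scale h w.2).

Lemma complex_sqr_ge0 (i : 'I_n) w : 0 <= complex_sqr i w.
Proof. by rewrite addr_ge0 ?sqr_ge0. Qed.

Lemma smooth_re m (E : normedModType R) (x : E) (f : E -> Cspace R m) j :
  smooth_at x f -> smooth_at x (fun y => (f y).1 0 j).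
Proof. by move=> fx; apply: smooth_at_coord; apply: smooth_at_fst. Qed.

Lemma smooth_im m (E : normedModType R) (x : E) (f : E -> Cspace R m) j :
  smooth_at x f -> smooth_at x (fun y => (f y).2 0 j).
Proof. by move=> fx; apply: smooth_at_coord; apply: smooth_at_snd. Qed.

Lemma smooth_complex_sqr (E : normedModType R) (x : E) (f : E -> W) i :
  smooth_at x f -> smooth_at x (fun y => complex_sqr i (f y)).
Proof.
by move=> fx; apply: smooth_atD; apply: smooth_atM;
  (exact: smooth_re || exact: smooth_im).
Qed.

Lemma smooth_complex_scale (E : normedModType R) (x : E) (h : 'I_n -> E -> R)
    (f : E -> W) : (forall i, smooth_at x (h i)) -> smooth_at x f ->
  smooth_at x (fun y => complex_scale (h ^~ y) (f y)).
Proof.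
move=> hx fx; apply: smooth_at_pair; apply: smooth_real_scale => //.
  exact: smooth_at_fst.
exact: smooth_at_snd.
Qed.

Lemma complex_sqr_scale i h w :
  complex_sqr i (complex_scale h w) = h i ^+ 2 * complex_sqr i w.
Proof. by rewrite /complex_sqr !mxE !exprMn mulrDr. Qed.

Lemma complex_scaleA h h' w :
  complex_scale h (complex_scale h' w) = complex_scale (fun i => h i * h' i) w.
Proof. by congr pair; apply: real_scaleA. Qed.

Lemma complex_scale1 w : complex_scale (fun=> 1) w = w.
Proof. by case: w => u v; congr pair; apply: real_scale1. Qed.

Lemma cvecE m (t : Cspace R m) j : cvec t 0 j = t.1 0 j +i* t.2 0 j.
Proof. by rewrite mxE. Qed.

Lemma mul_conj (x y : R) :
  (x +i* y) * Num.conj (x +i* y) = (x ^+ 2 + y ^+ 2)%:C.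
Proof. by apply/eqP; rewrite eq_complex /=; apply/andP; split; apply/eqP; ring. Qed.

Lemma torusE m (t : Cspace R m) : torus R m t <-> forall j, complex_sqr j t = 1.
Proof.
split=> tT j.
  have := tT j; move/(congr1 (fun z : R[i] => z ^+ 2)).
  rewrite /= normCK expr1n cvecE mul_conj => /eqP; rewrite eq_complex /= => /andP[/eqP].
  by [].
apply/eqP; rewrite -(@pexpr_eq1 _ _ 2) ?normr_ge0 // normCK cvecE mul_conj.
by rewrite -/(complex_sqr j t) tT.
Qed.

Lemma cmulE m (s t : Cspace R m) : cmul s t =
  (\row_j (s.1 0 j * t.1 0 j - s.2 0 j * t.2 0 j),
   \row_j (s.1 0 j * t.2 0 j + s.2 0 j * t.1 0 j)).
Proof. by congr pair; apply/rowP => j; rewrite !mxE. Qed.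

(** The entries are [t_0 / t_j], that is [t_0] times the conjugate of [t_j]. *)
Definition phase_ratio (t : Cspace R n.+1) : W :=
  (\row_j (t.1 0 0 * t.1 0 (lift 0 j) + t.2 0 0 * t.2 0 (lift 0 j)),
   \row_j (t.2 0 0 * t.1 0 (lift 0 j) - t.1 0 0 * t.2 0 (lift 0 j))).

Definition phase_section (h : W) : Cspace R n.+1 :=
  (\row_j (if unlift 0 j is Some i then h.1 0 i else 1),
   \row_j (if unlift 0 j is Some i then - h.2 0 i else 0)).

Lemma coneE m : @cone R m = (const_mx 1, const_mx 0).
Proof. by congr pair; apply/rowP => j; rewrite !mxE. Qed.

Lemma complex_sqr_mul m (s t : Cspace R m) j :
  complex_sqr j (cmul s t) = complex_sqr j s * complex_sqr j t.
Proof. by rewrite cmulE /complex_sqr !mxE; ring. Qed.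

Variable l : 'I_n.+1 -> R.
Hypothesis l_inj : injective l.

(** The polynomial of a Hermitian arrow matrix is the image of a real one, so the
    condition on the spectrum can be stated over the reals. *)
Lemma herm_spectrumP x :
  has_spectrum (herm_mx x) (fun i => (l i)%:C) <->
  isospectral_set (@complex_sqr n) l x.
Proof.
have inj_lC : injective (fun i => (l i)%:C) by move=> i j [/l_inj].
rewrite /herm_mx has_spectrum_arrow //; last by move=> z; rewrite conjC_eq0.
pose f := real_complex R : {rmorphism R -> R[i]}.
rewrite /isospectral_set /= /isospectral_data.
have -> : \prod_k ('X - ((l k)%:C)%:P) = map_poly f (\prod_k ('X - (l k)%:P)).
  by rewrite rmorph_prod; apply: eq_bigr => k _; rewrite /= map_polyXsubC.
have -> : arrow_poly ((\row_i (x.1 0 i)%:C) 0 0)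
    (fun i => (\row_i (x.1 0 i)%:C) 0 (lift 0 i))
    (fun i => cvec x.2 0 i * Num.conj (cvec x.2 0 i)) =
  map_poly f (arrow_poly (x.1 0 0) (diag_of x) (sqr_of (@complex_sqr n) x)).
  rewrite map_arrow_poly; congr arrow_poly; rewrite ?mxE //.
    by apply/funext => i; rewrite mxE.
  by apply/funext => i; rewrite cvecE mul_conj.
by split=> [/map_poly_inj|->].
Qed.

Lemma herm_isospectralE :
  herm_isospectral l = isospectral_set (@complex_sqr n) l.
Proof.
apply/seteqP; split=> x.
  move=> [A [AA AS] <-]; move: AS; rewrite -{1}(herm_coordK AA).
  by rewrite herm_spectrumP.
move=> xM; exists (herm_mx x); last exact: herm_mxK.
by split; [apply: herm_mx_arrow|apply/herm_spectrumP].
Qed.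

Lemma herm_act_ratio t x : torus R n.+1 t ->
  herm_act t x = (x.1, cmul (phase_ratio t) x.2).
Proof.
move=> tT; have t0 k : cvec t 0 k != 0 by rewrite -normr_gt0 tT ltr01.
have tV k : (cvec t 0 k)^-1 = Num.conj (cvec t 0 k).
  by rewrite invC_norm tT expr1n invr1 mul1r.
rewrite /herm_act /herm_coord; congr pair.
  apply/rowP => j; rewrite mxE conj_diag_mxE // mulrAC mulfV // mul1r mxE.
  by case: (unliftP 0 j) => [i|] ->; rewrite ?eqxx mxE.
congr rvec; apply/rowP => j.
rewrite [LHS]mxE conj_diag_mxE // tV [herm_mx _ _ _]mxE unlift_none liftK mulrAC.
rewrite [RHS]mxE; congr (_ * _); rewrite !cvecE !mxE.
by apply/eqP; rewrite eq_complex /=; apply/andP; split; apply/eqP; ring.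
Qed.

Theorem herm_locally_standard :
  locally_standard cmul cone (torus R n.+1) (scalar_torus R n.+1)
        cmul (torus R n) herm_act (herm_isospectral l).
Proof.
rewrite herm_isospectralE.
apply: (@isospectral_locally_standard _ _ _ _ (@complex_sqr n) complex_scale
  complex_sqr_ge0 smooth_complex_sqr smooth_complex_scale complex_sqr_scale
  complex_scaleA complex_scale1 _ l_inj _ _ _ _ _ cone _ _ phase_ratio phase_section).
- by apply/torusE => j; rewrite coneE /complex_sqr !mxE expr1n expr0n addr0.
- move=> s t /torusE Gs /torusE Gt; apply/torusE => j.
  by rewrite complex_sqr_mul Gs Gt mulr1.
- by move=> t [].
- move=> t /torusE Gt; apply/torusE => j.
  transitivity (complex_sqr 0 t * complex_sqr (lift 0 j) t).
    by rewrite /complex_sqr !mxE; ring.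
  by rewrite !Gt mulr1.
- by rewrite !coneE /phase_ratio /=; congr pair; apply/rowP => j; rewrite !mxE; ring.
- move=> s t _ _; rewrite !cmulE /phase_ratio /=.
  by congr pair; apply/rowP => j; rewrite !mxE /=; ring.
- move=> s t /torusE Gs /torusE Gt; split.
    move=> [/rowP e1 /rowP e2].
    (* the scalar s_0 / t_0 carries t to s *)
    pose u1 := s.1 0 0 * t.1 0 0 + s.2 0 0 * t.2 0 0.
    pose u2 := s.2 0 0 * t.1 0 0 - s.1 0 0 * t.2 0 0.
    have S0 : s.1 0 0 ^+ 2 + s.2 0 0 ^+ 2 = 1 := Gs 0.
    have T0 : t.1 0 0 ^+ 2 + t.2 0 0 ^+ 2 = 1 := Gt 0.
    exists (const_mx u1, const_mx u2).
      split; last by exists (u1 +i* u2); apply/rowP => j; rewrite !mxE.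
      apply/torusE => j; rewrite /complex_sqr !mxE -[RHS]mulr1 -{1}S0 -T0 /u1 /u2.
      ring.
    rewrite cmulE [LHS]surjective_pairing; congr pair; apply/rowP => j; rewrite !mxE /=.
      case: (unliftP 0 j) => [i|] ->; last first.
        by rewrite -[LHS]mulr1 -T0 /u1 /u2; ring.
      have := e1 i; have := e2 i; rewrite !mxE => f2 f1.
      transitivity (s.1 0 0 * (t.1 0 0 * t.1 0 (lift 0 i) + t.2 0 0 * t.2 0 (lift 0 i))
         + s.2 0 0 * (t.2 0 0 * t.1 0 (lift 0 i) - t.1 0 0 * t.2 0 (lift 0 i))).
        by rewrite -f1 -f2 -[LHS]mulr1 -S0; ring.
      by rewrite /u1 /u2; ring.
    case: (unliftP 0 j) => [i|] ->; last first.
      by rewrite -[LHS]mulr1 -T0 /u1 /u2; ring.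
    have := e1 i; have := e2 i; rewrite !mxE => f2 f1.
    transitivity (s.2 0 0 * (t.1 0 0 * t.1 0 (lift 0 i) + t.2 0 0 * t.2 0 (lift 0 i))
       - s.1 0 0 * (t.2 0 0 * t.1 0 (lift 0 i) - t.1 0 0 * t.2 0 (lift 0 i))).
      by rewrite -f1 -f2 -[LHS]mulr1 -S0; ring.
    by rewrite /u1 /u2; ring.
  move=> [u [/torusE Gu [k /rowP uE]] ->].
  have uj j : u.1 0 j = complex.Re k /\ u.2 0 j = complex.Im k.
    by have := uE j; rewrite cvecE mxE => <-.
  have K1 : complex.Re k ^+ 2 + complex.Im k ^+ 2 = 1.
    by have := Gu 0; rewrite /complex_sqr !(uj 0).1 !(uj 0).2.
  rewrite cmulE /phase_ratio /=; congr pair; apply/rowP => j; rewrite !mxE /=;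
    rewrite !(uj _).1 !(uj _).2 -[RHS]mul1r -K1; ring.
- move=> t; rewrite cmulE coneE [RHS]surjective_pairing.
  by congr pair; apply/rowP => j; rewrite !mxE /=; ring.
- move=> t; rewrite cmulE coneE [RHS]surjective_pairing.
  by congr pair; apply/rowP => j; rewrite !mxE /=; ring.
- move=> u v w; rewrite !cmulE.
  by congr pair; apply/rowP => j; rewrite !mxE /=; ring.
- move=> h /torusE Hh; apply/torusE => j; rewrite /complex_sqr !mxE.
  case: (unlift 0 j) => [i|]; last by rewrite expr1n expr0n addr0.
  by rewrite sqrrN -[RHS](Hh i).
- move=> h _; rewrite [RHS]surjective_pairing /phase_ratio /=.
  by congr pair; apply/rowP => j; rewrite !mxE !unlift_none !liftK; ring.
- move=> h; apply: smooth_at_continuous; apply: smooth_at_pair.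
    apply: smooth_at_row => j; case: (unlift 0 j) => [i|].
      by apply: smooth_re; apply: smooth_at_id.
    exact: smooth_at_cst.
  apply: smooth_at_row => j; case: (unlift 0 j) => [i|].
    by apply: smooth_atN; apply: smooth_im; apply: smooth_at_id.
  exact: smooth_at_cst.
- move=> F x f fx; apply: smooth_at_pair; apply: smooth_at_row => j.
    by apply: smooth_atD; apply: smooth_atM; (exact: smooth_re || exact: smooth_im).
  by apply: smooth_atB; apply: smooth_atM; (exact: smooth_re || exact: smooth_im).
- move=> F x f g fx gx.
  rewrite (_ : (fun y => _) = fun y =>
    (\row_j ((f y).1 0 j * (g y).1 0 j - (f y).2 0 j * (g y).2 0 j),
     \row_j ((f y).1 0 j * (g y).2 0 j + (f y).2 0 j * (g y).1 0 j))); last first.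
    by apply/funext => y; rewrite cmulE.
  apply: smooth_at_pair; apply: smooth_at_row => j.
    by apply: smooth_atB; apply: smooth_atM; (exact: smooth_re || exact: smooth_im).
  by apply: smooth_atD; apply: smooth_atM; (exact: smooth_re || exact: smooth_im).
- exact: herm_act_ratio.
- by move=> i h w /torusE Hh; rewrite complex_sqr_mul Hh mul1r.
- move=> k h w; rewrite !cmulE /complex_scale /=.
  by congr pair; apply/rowP => j; rewrite !mxE /=; ring.
Qed.

(** C^n as R^(2n). *)
Definition concat (w : W) : 'rV[R]_(n + n) := row_mx w.1 w.2.
Definition split_halves (v : 'rV[R]_(n + n)) : W := (lsubmx v, rsubmx v).

Lemma concatK : cancel concat split_halves.
Proof. by case=> u v; rewrite /split_halves row_mxKl row_mxKr. Qed.

Lemma split_halvesK : cancel split_halves concat.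
Proof. by move=> v; rewrite /concat hsubmxK. Qed.

Lemma continuous_concat : continuous concat.
Proof.
move=> w; apply: smooth_at_continuous.
have -> : concat = fun w => \row_j (match fintype.split j with
    inl i => w.1 0 i | inr i => w.2 0 i end).
  by apply/funext => u; apply/rowP => j; rewrite !mxE; case: (fintype.split j).
apply: smooth_at_row => j; case: (fintype.split j) => i.
  by apply: (@smooth_re n _ w id); apply: smooth_at_id.
by apply: (@smooth_im n _ w id); apply: smooth_at_id.
Qed.

Lemma continuous_split_halves : continuous split_halves.
Proof.
have -> : split_halves = fun v => (\row_j v 0 (lshift n j), \row_j v 0 (rshift n j)).
  by apply/funext => v; congr pair; apply/rowP => j; rewrite !mxE.
move=> v; apply: smooth_at_continuous; apply: smooth_at_pair;
  by apply: smooth_at_row => j; apply: smooth_at_coord; apply: smooth_at_id.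
Qed.

Theorem herm_smooth_manifold : smooth_manifold (2 * n)%N (herm_isospectral l).
Proof.
rewrite herm_isospectralE mul2n -addnn => x xM.
have [U [D [f [g [rU Ux oD fg _]]]]] := isospectral_chart complex_sqr_ge0
  smooth_complex_sqr smooth_complex_scale complex_sqr_scale complex_scaleA
  complex_scale1 l_inj xM.
exists U, (split_halves @^-1` D), (concat \o f), (g \o split_halves); split=> //.
  by apply: open_comp => // v _; apply: continuous_split_halves.
apply: diffeo_linear => //.
- by move=> a u v; rewrite /concat -add_row_mx -scale_row_mx.
- exact: continuous_concat.
- by move=> a u v; congr pair; rewrite /= linearP.
- exact: continuous_split_halves.
- exact: concatK.
- exact: split_halvesK.
Qed.

End ComplexCase.

Theorem theorem4p4 (R : realType) (n : nat) (lambda : 'I_n.+1 -> R)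
    (n_ge1 : (1 <= n)%N)
    (lambda_lt : forall i j : 'I_n.+1, (i < j)%N -> lambda i < lambda j) :
  [/\ smooth_manifold (2 * n)%N (herm_isospectral lambda),
      smooth_manifold n (symm_isospectral lambda),
      locally_standard cmul cone (torus R n.+1) (scalar_torus R n.+1)
        cmul (torus R n) herm_act (herm_isospectral lambda) &
      locally_standard rmul rone (signs R n.+1) (scalar_signs R n.+1)
        rmul (signs R n) symm_act (symm_isospectral lambda)].
Proof.
have l_inj : injective lambda.
  move=> i j lij; apply/eqP; apply: contraT => ij.
  case: (ltngtP i j) => [/lambda_lt|/lambda_lt|/val_inj ij'].
  - by rewrite lij ltxx.
  - by rewrite lij ltxx.
  - by rewrite ij' eqxx in ij.
split.
- exact: herm_smooth_manifold.
- exact: symm_smooth_manifold.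
- exact: herm_locally_standard.
- exact: symm_locally_standard.
Qed.
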